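(* Let $n>k\ge1$ be coprime integers, $\ell\ge 1$, and $r,s\in\mathbb{Z}$ with $rn=ks+1$. Consider nonzero complex numbers $\varepsilon,\lambda_1,\dots,\lambda_\ell,\xi_1,\dots,\xi_{k+1}$ and set $$\eta_1:=(-1)^{k-1}\varepsilon^r\prod_{i=1}^{k}\xi_i^{-1},\qquad \eta_2:=(-1)^{k-1}\varepsilon^r\xi_{k+1}^{-1}\prod_{i=1}^{k-1}\xi_i^{-1}.$$ Assume $\lambda_1,\dots,\lambda_\ell,\eta_1,\eta_2$ are distinct from $1$; $\lambda_1,\dots,\lambda_\ell\ne\eta_1$; $\xi_i\neq\xi_j$ for $i\ne j$; $\xi_1+\cdots+\xi_k\ne0$; $\xi_1+\cdots+\xi_{k-1}+\xi_{k+1}\ne0$; $\xi_1^k,\dots,\xi_{k+1}^k\ne\varepsilon^r$; and the Fuchs relation $$\lambda_1\cdots\lambda_\ell\,\xi_1^\ell\cdots\xi_{k-1}^\ell\,\xi_k^{\ell-1}\,\xi_{k+1}=(-1)^{(k-1)\ell}\varepsilon^{r\ell}.$$ Then: (i) There are irreducible rigid Pochhammer local systems $\mathcal{F}$ and $\mathcal{G}$ of multiplicity one on $T_{n,k,\bullet}$ determined, respectively, by the numerical local data $(\varepsilon;\eta_1;\xi_1,\dots,\xi_k)$ and $(\varepsilon;\eta_2;\xi_1,\dots,\xi_{k-1},\xi_{k+1})$. (ii) There is a rigid Pochhammer local system $\widetilde{\mathcal{L}}$ of multiplicity one on $D'_\bullet$ determined by the numerical local data $(\lambda_1,\dots,\lambda_\ell;\eta_1,\eta_2)$.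 (iii) The tuple $(\varepsilon;\lambda_1,\dots,\lambda_\ell;\xi_1,\dots,\xi_{k+1};\ell,\dots,\ell,\ell-1,1)$ is the numerical local data of an irreducible rigid Pochhammer local system of multiplicity one on $T_{n,k,\ell}$ with semi-simple monodromy at infinity, obtained as an extension of $\mathcal{F}^{\oplus(\ell-1)}\oplus\mathcal{G}$ via $\widetilde{\mathcal{L}}$. Moreover, this extension is unique (up to isomorphism).
   Context: Local systems are locally constant sheaves of finite-dimensional complex vector spaces; $\varrho$ denotes monodromy representation. A pseudo-reflection is an invertible matrix $M$ with $\mathrm{codim}\ker(M-\mathbf{I})=1$; its special eigenvalue is $\det M$, always assumed $\ne1$. Turbines. Let $C_1,\dots,C_\ell$ be distinct nonzero complex numbers, $Y_0=\{y=0\}$, $Y_i=\{y^k=C_ix^n\}$. For closed discs $D_{\rho_1},D_{\rho_2}\subset\mathbb{C}$ centered at $0$, $0<\rho_1\ll\rho_2$ suitable, let $N_\infty=\partial D_{\rho_1}\times D_{\rho_2}$, and let $N_0,\dots,N_\ell\subset\mathrm{int}(N_\infty)$ be disjoint thin closed tubular neighbourhoods of the knots $Y_i\cap\partial(D_{\rho_1}\times D_{\rho_2})$. $T^*_{n,k,\ell}=N_\infty\setminus\bigcup_{i=0}^\ell\mathrm{int}(N_i)$, and $T_{n,k,\ell}=N_\infty\setminus\bigcup_{i=1}^\ell\mathrm{int}(N_i)$ is the turbine without shaft. With $\alpha_i,\beta_i$ the standard meridian and parallel of $\partial N_i$, and $\delta=\alpha_i^n\beta_i^k$, $\omega_i=\alpha_i^s\beta_i^r$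 for $i=0,\infty$ (so $\alpha_i=\delta^r\omega_i^{-k}$), one has $\pi_1(T^*_{n,k,\ell})=\langle\alpha_1,\dots,\alpha_\ell,\omega_0,\omega_\infty:\alpha_1\cdots\alpha_\ell\omega_\infty=\omega_0\rangle\times\langle\delta\rangle$ ($\langle\delta\rangle$ infinite cyclic), and $\pi_1(T_{n,k,\ell})$ is the quotient by $\omega_0^k=\delta^r$. $\pi_1(\partial N_\infty)$ is generated by $\omega_\infty,\delta$, and $\pi_1(\partial N_i)$ by $\alpha_i,\delta$ ($1\le i\le\ell$). Let $N_\bullet$ be a solid torus with $N_i\subset N_\bullet\subset N_\infty\setminus N_0$ for $1\le i\le\ell$ such that $T_{n,k,\bullet}=N_\infty\setminus\mathrm{int}(N_\bullet)$ is a turbine without shaft and with parameters $n,k,1$. In it the role of ''$\alpha_1$'' is played by $\alpha_\bullet=\alpha_1\cdots\alpha_\ell$. $D_\bullet$ is a disc section transversal to $N_\bullet$, $D_i\subset D_\bullet$ disc sections of $N_i$, $D'_\bullet=D_\bullet\setminus\bigcup_{i=1}^\ell\mathrm{int}(D_i)$, so $\pi_1(D'_\bullet)$ is free on $\alpha_1,\dots,\alpha_\ell$ and the outer boundary $\partial D_\bullet$ is $\alpha_\bullet$. Rigidity. A local system on a turbine without shaft is rigid if it is determined up to isomorphism by its restrictions to the boundary tori $\partial N_i$, $i\in\{1,\dots,\ell,\infty\}$. A local system on $D'_\bullet$ is rigid if it is determined up to isomorphism by its restrictions to $\partial D_1,\dots,\partial D_\ell,\partial D_\bullet$. Pochhammer.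 Let $U$ be a simply connected planar domain minus finitely many points (or discs), with $\pi_1(U)$ freely generated by simple loops $\gamma_1,\dots,\gamma_N$ around them. A local system on $U$ with fibre $V$ is Pochhammer if $\dim V=\sum_i\mathrm{codim}\,V^{\gamma_i}$ and $\bigcap_iV^{\gamma_i}=0$, where $V^{\gamma}=\ker(\varrho(\gamma)-1)$; it has multiplicity one if all $\mathrm{codim}\,V^{\gamma_i}=1$. A local system on a turbine is Pochhammer [of multiplicity one] if its restriction to the section $U$ of the turbine by a generic line ($x=$ const) is; for $T_{n,k,\ell}$ the loops are $\omega_0^{k-1-j}\alpha_i\omega_0^{1-k+j}$ ($0\le j\le k-1$, $1\le i\le\ell$). Semi-simple monodromy at infinity means $\varrho(\omega_\infty)$ is semi-simple. Numerical local data. On $T_{n,k,\ell}$: $(\varepsilon;\lambda_1,\dots,\lambda_\ell;\xi_1,\dots,\xi_\nu;m_1,\dots,m_\nu)$ means $\varrho(\delta)=\varepsilon\mathbf{I}$; $\varrho(\alpha_i)$ is a pseudo-reflection with special eigenvalue $\lambda_i$; $\varrho(\omega_0)$ is conjugate to $\zeta_1\mathbf{I}_\ell\oplus\cdots\oplus\zeta_k\mathbf{I}_\ell$ with $\zeta_1,\dots,\zeta_k$ the $k$-th roots of $\varepsilon^r$; $\varrho(\omega_\infty)$ is conjugate to $\xi_1\mathbf{I}_{m_1}\oplus\cdots\oplus\xi_\nu\mathbf{I}_{m_\nu}$ with distinct $\xi_j$ (an eigenvalue with multiplicity $0$ is absent). Omitted $m_j$ are all equal to $1$. On $D'_\bullet$: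 $(\lambda_1,\dots,\lambda_\ell;\eta_1,\eta_2)$ means rank $\ell$, $\varrho(\alpha_i)$ a pseudo-reflection with special eigenvalue $\lambda_i$, and $\varrho(\alpha_\bullet)$ conjugate to $\eta_1\mathbf{I}_{\ell-1}\oplus\eta_2$. Extension. A Pochhammer local system $\mathcal{L}$ on $T_{n,k,\ell}$ is an extension of $\mathcal{L}'$ (Pochhammer on $T_{n,k,\bullet}$) via $\widetilde{\mathcal{L}}$ (Pochhammer on $D'_\bullet$) if $\mathcal{L}|_{T_{n,k,\bullet}}\simeq\mathcal{L}'$ and there is a constant subsheaf $\mathcal{K}\subset\mathcal{L}|_{D'_\bullet}$ with $\mathcal{L}|_{D'_\bullet}/\mathcal{K}\simeq\widetilde{\mathcal{L}}$. *)

(* Defs.v *)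
From mathcomp Require Export all_boot all_order all_algebra.
From mathcomp Require Export reals.
From mathcomp.real_closed Require Export complex.

Set Implicit Arguments.
Unset Strict Implicit.
Unset Printing Implicit Defensive.

Import GRing.Theory.
Local Open Scope ring_scope.

(* A local system on a connected space is given by its monodromy representation,
   i.e. by one invertible matrix for each generator of the fundamental group,
   subject to the defining relations.  Monodromy matrices act on the left on
   column vectors, and words are mapped to products in the same order.
   Since the subspaces of mxalgebra are row spaces, a subspace of the fibre is
   represented by a matrix whose rows span the transposes of its vectors. *)

Section LinearAlgebra.
Variable C : fieldType.

Definition mxpowz N (M : 'M[C]_N) (z : int) : 'M[C]_N :=
  match z with
  | Posz p => M ^+ p
  | Negz p => (invmx M) ^+ p.+1
  end.

(* An invertible rectangular matrix is automatically square; this form allows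
   two conjugate matrices to have provably but not definitionally equal size. *)
Definition conjugate N N' (M : 'M[C]_N) (M' : 'M[C]_N') : Prop :=
  exists P : 'M[C]_(N', N), [/\ row_free P, row_full P & P *m M = M' *m P].

Definition fixed_space N (M : 'M[C]_N) : 'M[C]_N := kermx (M - 1%:M)^T.

Definition codim_fixed N (M : 'M[C]_N) : nat := N - \rank (fixed_space M).

Definition pseudo_reflection N (M : 'M[C]_N) (lambda : C) : Prop :=
  [/\ M \in unitmx, codim_fixed M = 1%N, \det M = lambda & lambda != 1].

(* x_1 I_{m_1} (+) ... (+) x_p I_{m_p} *)
Definition scalar_blocks p (x : 'I_p -> C) (m : 'I_p -> nat) :
    'M[C]_(\sum_i m i) :=
  @mxdiag C p m (fun i => (x i)%:M).

End LinearAlgebra.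

Section Families.
Variable C : fieldType.

Record rep (I : Type) := Rep {
  rk : nat;
  mon :> I -> 'M[C]_rk
}.

Definition rep_iso I (L L' : rep I) : Prop :=
  exists P : 'M[C]_(rk L', rk L),
    [/\ row_free P, row_full P & forall g, P *m L g = L' g *m P].

Definition irreducible I (L : rep I) : Prop :=
  (0 < rk L)%N /\
  forall U : 'M[C]_(rk L), (forall g, stablemx U (L g)^T) ->
    U = 0 \/ row_full U.

Definition rep_sum I (L L' : rep I) : rep I :=
  Rep (fun g => block_mx (L g) 0 0 (L' g)).

Definition rep_mul I (L : rep I) (m : nat) : rep I :=
  @Rep I (\sum_(i < m) rk L) (fun g => @mxdiag C m (fun _ => rk L) (fun _ => L g)).

(* The quotient of L by the stable subspace K is isomorphic to L', i.e. there
   is an equivariant surjection q of fibres with kernel K. *)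
Definition quotient_iso I (L : rep I) (K : 'M[C]_(rk L)) (L' : rep I) : Prop :=
  exists q : 'M[C]_(rk L', rk L),
    [/\ row_free q, (kermx q^T :=: K)%MS & forall g, q *m L g = L' g *m q].

(* The index type J enumerates the free generators of the fundamental group of
   a punctured planar domain. *)
Definition pochhammer_family (J : finType) N (M : J -> 'M[C]_N) : Prop :=
  N = (\sum_j codim_fixed (M j))%N /\
  (\bigcap_j fixed_space (M j))%MS = 0.

End Families.

(* Generators of the fundamental group of the turbine without shaft
   T_{n,k,l}.  The presentation depends on n only through the exponent r, where
   r n = k s + 1.  The case l = 1 is T_{n,k,bullet}. *)
Inductive turbine_gen (l : nat) :=
  | Alpha of 'I_l
  | Omega0
  | Omega_inf
  | Delta.
Arguments Omega0 {l}.
Arguments Omega_inf {l}.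
Arguments Delta {l}.

Section Disc.
Variables (C : fieldType) (l : nat).
Implicit Types L : rep C 'I_l.

Definition disc_local_system L : Prop := forall i, L i \in unitmx.

Definition disc_outer L : 'M[C]_(rk L) := \prod_(i < l) L i.

Definition disc_rigid L : Prop :=
  forall L', disc_local_system L' ->
    (forall i, conjugate (L i) (L' i)) ->
    conjugate (disc_outer L) (disc_outer L') ->
    rep_iso L L'.

Definition disc_pochhammer L : Prop := pochhammer_family L.

Definition disc_pochhammer1 L : Prop :=
  disc_pochhammer L /\ forall i, codim_fixed (L i) = 1%N.

Definition disc_local_data L (lambda : 'I_l -> C) (eta1 eta2 : C) : Prop :=
  [/\ rk L = l,
      forall i, pseudo_reflection (L i) (lambda i) &
      conjugate (disc_outer L)
        (block_mx (eta1%:M : 'M[C]_(l.-1)) 0 0 (eta2%:M : 'M[C]_1))].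

End Disc.

Section Turbine.
Variables (C : fieldType) (k : nat) (r : int) (l : nat).
Implicit Types L : rep C (turbine_gen l).

Definition turbine_local_system L : Prop :=
  [/\ forall g, L g \in unitmx,
      (\prod_(i < l) L (Alpha i)) *m L Omega_inf = L Omega0,
      forall g, L g *m L Delta = L Delta *m L g &
      L Omega0 ^+ k = mxpowz (L Delta) r].

(* Restriction to a boundary torus, given by the matrices of two generators of
   its fundamental group. *)
Definition torus_rep N (M D : 'M[C]_N) : rep C bool :=
  Rep (fun b => if b then M else D).

Definition turbine_rigid L : Prop :=
  forall L', turbine_local_system L' ->
    (forall i, rep_iso (torus_rep (L (Alpha i)) (L Delta))
                       (torus_rep (L' (Alpha i)) (L' Delta))) ->
    rep_iso (torus_rep (L Omega_inf) (L Delta))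
            (torus_rep (L' Omega_inf) (L' Delta)) ->
    rep_iso L L'.

(* The loops omega_0^(k-1-j) alpha_i omega_0^(1-k+j) in the section of the
   turbine by a generic line. *)
Definition section_loop L (ji : 'I_k * 'I_l) : 'M[C]_(rk L) :=
  L Omega0 ^+ (k - 1 - ji.1) *m L (Alpha ji.2)
    *m (invmx (L Omega0)) ^+ (k - 1 - ji.1).

Definition turbine_pochhammer L : Prop := pochhammer_family (section_loop L).

Definition turbine_pochhammer1 L : Prop :=
  turbine_pochhammer L /\ forall ji, codim_fixed (section_loop L ji) = 1%N.

(* zeta lists the k-th roots of epsilon^r. *)
Definition turbine_local_data L (epsilon : C) (lambda : 'I_l -> C) (nu : nat)
    (xi : 'I_nu -> C) (m : 'I_nu -> nat) : Prop :=
  [/\ L Delta = epsilon%:M,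
      forall i, pseudo_reflection (L (Alpha i)) (lambda i),
      exists zeta : 'I_k -> C,
        [/\ injective zeta,
            forall z, z ^+ k = epsilon ^ r <-> exists j, zeta j = z &
            conjugate (L Omega0) (scalar_blocks zeta (fun _ => l))],
      injective xi &
      conjugate (L Omega_inf) (scalar_blocks xi m)].

Definition turbine_to_disc L : rep C 'I_l := Rep (fun i => L (Alpha i)).

Definition turbine_to_bullet L : rep C (turbine_gen 1) :=
  Rep (fun g : turbine_gen 1 =>
    match g with
    | Alpha _ => \prod_(i < l) L (Alpha i)
    | Omega0 => L Omega0
    | Omega_inf => L Omega_inf
    | Delta => L Delta
    end).

End Turbine.

(* K is the fibre of the constant subsheaf: a subspace on which every alpha_i
   acts trivially. *)
Definition extension_via (C : fieldType) (k l : nat)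
    (L : rep C (turbine_gen l)) (L' : rep C (turbine_gen 1))
    (Lt : rep C 'I_l) : Prop :=
  [/\ turbine_pochhammer k L, turbine_pochhammer k L', disc_pochhammer Lt,
      rep_iso (turbine_to_bullet L) L' &
      exists2 K : 'M[C]_(rk L),
        (forall i, (K <= fixed_space (L (Alpha i)))%MS) &
        @quotient_iso C _ (turbine_to_disc L) K Lt].

(* Main.v *)
Require Import Defs.
From mathcomp Require Import separable zify ring.

(* Local data are encoded by ranks of [M - x], and every uniqueness statement,
   including that of the extension, comes from one rigidity argument of Katz:
   if L is irreducible with index of rigidity 2 and L' has the same local data,
   Scott's lemma applied to Hom(L, L') yields a nonzero morphism L -> L' or
   L' -> L, hence an isomorphism.  The spectrum of omega_0 need not be prescribed:
   omega_0 ^ k = epsilon ^ r, and as omega_inf has no k-th root of epsilon ^ r as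
   an eigenvalue, each eigenspace of omega_0 meets the common fixed space of the
   alpha_i trivially, which bounds its dimension by l and so makes it equal to l.

   Existence is explicit.  F and G are hypergeometric groups given by companion
   matrices, and Lt is a Jordan-Pochhammer tuple.  On F^(l-1) + G the monodromy
   alpha_bullet is conjugate to the direct sum of an identity matrix and of
   alpha_bullet(Lt), and in the corresponding basis alpha_i is taken to be the
   direct sum of the same identity matrix and of alpha_i(Lt).  A subspace S stable
   under L projects to a stable subspace of the fibre of Lt, so alpha_bullet acts
   trivially on S or on the quotient by S, where omega_0 and omega_inf then agree;
   their k-th powers having no common eigenvalue, S is 0 or everything. *)

Set Implicit Arguments.
Unset Strict Implicit.
Unset Printing Implicit Defensive.

Import GRing.Theory.
Local Open Scope ring_scope.

(** * Conjugacy classes of diagonalizable matrices *)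

Section Conjugation.
Variable C : fieldType.

Lemma conjugate_dim N N' (M : 'M[C]_N) (M' : 'M[C]_N') :
  conjugate M M' -> N = N'.
Proof. by move=> [P [/eqP rkN' /eqP rkN _]]; rewrite -rkN rkN'. Qed.

Lemma conjugate_rank N N' (M : 'M[C]_N) (M' : 'M[C]_N') x :
  conjugate M M' -> \rank (M - x%:M) = \rank (M' - x%:M).
Proof.
move=> [P [Pfree Pfull PM]].
rewrite -(mxrankMfree (M' - _) Pfree) -(eqmxMfull (M - _) Pfull).
by rewrite mulmxBr mulmxBl PM scalar_mxC.
Qed.

Lemma conjugate_square N (M M' : 'M[C]_N) :
  conjugate M M' <-> exists2 P, P \in unitmx & P *m M = M' *m P.
Proof.
split=> [[P [Pfree _ PM]]|[P Pu PM]]; exists P => //; first by rewrite -row_free_unit.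
by split; rewrite ?row_free_unit ?row_full_unit.
Qed.

Lemma conjugate_sym N N' (M : 'M[C]_N) (M' : 'M[C]_N') :
  conjugate M M' -> conjugate M' M.
Proof.
move=> cMM'; have e := conjugate_dim cMM'; subst N'.
have /conjugate_square[P Pu PM] := cMM'; apply/conjugate_square.
by exists (invmx P); rewrite ?unitmx_inv // -[M'](mulmxK Pu) -PM !mulmxA mulVmx ?mul1mx.
Qed.

Lemma conjugate_trans N1 N2 N3 (M1 : 'M[C]_N1) (M2 : 'M[C]_N2) (M3 : 'M[C]_N3) :
  conjugate M1 M2 -> conjugate M2 M3 -> conjugate M1 M3.
Proof.
move=> c12 c23; have e := conjugate_dim c12; have e' := conjugate_dim c23.
subst N2 N3; have /conjugate_square[P Pu PM] := c12.
have /conjugate_square[Q Qu QM] := c23; apply/conjugate_square.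
exists (Q *m P); first by rewrite unitmx_mul Qu.
by rewrite -mulmxA PM !mulmxA QM.
Qed.

Lemma rank_scalar_mx N (x : C) : \rank (x%:M : 'M_N) = ((x != 0%R) * N)%N.
Proof.
have [->|x0] := eqVneq x 0; first by rewrite raddf0 mxrank0.
by rewrite mul1n -scalemx1 mxrank_scale_nz ?mxrank1.
Qed.

Lemma rank_scalar_blocks p (x : 'I_p -> C) (m : 'I_p -> nat) y :
  \rank (scalar_blocks x m - y%:M) = (\sum_a (x a != y) * m a)%N.
Proof.
rewrite /scalar_blocks -mxdiagZ -mxdiagB rank_mxdiag; apply: eq_bigr => a _.
by rewrite -raddfB /= rank_scalar_mx subr_eq0.
Qed.

(** Eigenspaces for distinct eigenvalues are independent and the [m a] add up to [N], so [m a]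
    independent left eigenvectors chosen for each [x a] form a basis. Upper bounds on the ranks of
    [M - x a] thus suffice to fix the conjugacy class. *)
Lemma conjugate_scalar_blocks p (x : 'I_p -> C) (m : 'I_p -> nat) N (M : 'M[C]_N) :
    injective x -> (\sum_a m a = N)%N ->
    (forall a, \rank (M - (x a)%:M)%R + m a <= N)%N ->
  conjugate M (scalar_blocks x m).
Proof.
move=> x_inj sum_m rk_m; pose E a := eigenspace M (x a).
have rkE a : (m a <= \rank (E a))%N.
  by rewrite mxrank_ker leq_subRL ?rank_leq_row // rk_m.
pose B a : 'M_(m a, N) := pid_mx (m a) *m row_base (E a).
have BM a : B a *m M = x a *: B a.
  by apply/eigenspaceP; rewrite (submx_trans (submxMl _ _)) ?eq_row_base.
have B_free a : row_free (B a).
  rewrite /row_free mxrankMfree ?row_base_free //.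
  by rewrite rank_pid_mx.
pose P := \mxcol_a B a.
have rkP : \rank P = N.
  have PE : (P :=: \sum_a <<B a>>)%MS.
    exact: eqmx_col.
  have dirE : mxdirect (\sum_a <<B a>>).
    have /mxdirect_sumsP dE : mxdirect (\sum_a E a).
      by apply: mxdirect_sum_eigenspace => a b _ _; apply: x_inj.
    have sBE a : (<<B a>> <= E a)%MS by rewrite genmxE; apply/eigenspaceP/BM.
    apply/mxdirect_sumsP => a _; have /eqP := dE a isT.
    rewrite -submx0 => dEa; apply/eqP; rewrite -submx0; apply: submx_trans dEa.
    apply: capmxS (sBE a) _; apply/sumsmx_subP => b ba.
    exact: submx_trans (sBE b) (sumsmx_sup b ba (submx_refl _)).
  rewrite PE (mxdirectP dirE) /= -[RHS]sum_m; apply: eq_bigr => a _.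
  by rewrite genmxE; apply/eqP/B_free.
exists P; split; rewrite /row_free /row_full ?rkP ?sum_m //.
rewrite mxcol_mul mul_mxdiag_mxcol; apply: eq_mxcol => a.
by rewrite BM mul_scalar_mx.
Qed.

Lemma conjugate_scalar_blocks_rank p (x : 'I_p -> C) (m : 'I_p -> nat) N (M : 'M[C]_N) a :
  conjugate M (scalar_blocks x m) -> (\rank (M - (x a)%:M)%R + m a <= N)%N.
Proof.
move=> cM; rewrite (conjugate_rank _ cM) rank_scalar_blocks (conjugate_dim cM).
rewrite (bigD1 a) //= eqxx mul0n add0n addnC.
rewrite [leqRHS](bigD1 a) //= leq_add2l.
by apply: leq_sum => b _; case: (_ != _); rewrite ?mul1n.
Qed.

Lemma conjugate_scalar_blocks_unit p (x : 'I_p -> C) (m : 'I_p -> nat) N (M : 'M[C]_N) y :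
  conjugate M (scalar_blocks x m) -> (forall a, x a != y) -> M - y%:M \in unitmx.
Proof.
move=> cM x_y; rewrite -row_free_unit /row_free (conjugate_rank _ cM).
rewrite rank_scalar_blocks (conjugate_dim cM); apply/eqP/eq_bigr => a _.
by rewrite x_y mul1n.
Qed.

(** [P a] conjugates back the coordinate projector onto the block of index [a]. *)
Lemma spectral_projections p (x : 'I_p -> C) (m : 'I_p -> nat) N (M : 'M[C]_N) :
    conjugate M (scalar_blocks x m) ->
  exists P : 'I_p -> 'M[C]_N,
    [/\ \sum_a P a = 1%:M, forall a, M *m P a = x a *: P a &
        forall a, \rank (P a) = m a].
Proof.
move=> cM; have e := conjugate_dim cM; move: M cM; rewrite e => M.
move=> /conjugate_square[Q Qu QM].
pose E a := \mxdiag_b ((b == a)%:R%:M : 'M[C]_(m b)).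
exists (fun a => invmx Q *m E a *m Q); split.
- rewrite -mulmx_suml -mulmx_sumr -mxdiag_sum /=.
  under eq_mxdiag => b.
    rewrite (bigD1 b) //= eqxx big1 ?addr0; last first.
      by move=> a; rewrite eq_sym => /negPf->; rewrite raddf0.
    over.
  by rewrite mxdiagZ mulmx1 mulVmx.
- move=> a; have SE : scalar_blocks x m *m E a = x a *: E a.
    rewrite -mul_scalar_mx -mxdiagZ !mul_mxdiag_mxblock.
    apply/eq_mxblockP => b c; rewrite !mul_scalar_mx; case: eqP => [e1|_].
      case: eqP => [-> //|_]; rewrite raddf0.
      by case: _ / e1; rewrite conform_mx_id !scaler0.
    by rewrite !scaler0.
  rewrite -[M in LHS](mulKmx Qu) QM !mulmxA mulmxK // -(mulmxA _ _ (E a)) SE.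
  by rewrite -scalemxAr -scalemxAl.
- move=> a; rewrite mxrankMfree ?row_free_unit //.
  rewrite eqmxMfull ?row_full_unit ?unitmx_inv // rank_mxdiag.
  rewrite (bigD1 a) //= big1 ?addn0 => [|b /negPf ba].
    by rewrite eqxx mxrank1.
  by rewrite ba raddf0 mxrank0.
Qed.

End Conjugation.

(** * Scott's lemma and Katz rigidity *)

Section Rigidity.
Variable C : fieldType.

(** Identifies linear forms on matrices with matrices through the trace pairing; this turns the
    invariant form found by Scott's lemma into an intertwiner. *)
Lemma mxvec_mxtrace m n (A B : 'M[C]_(m, n)) :
  mxvec A *m (mxvec B)^T = (\tr (A *m B^T))%:M.
Proof.
have -> : \tr (A *m B^T) = \sum_i \sum_j A i j * B i j.
  apply: eq_bigr => i _; rewrite mxE.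
  by apply: eq_bigr => j _; rewrite mxE.
apply/rowP=> i; rewrite {i}ord1 !mxE (reindex _ (curry_mxvec_bij _ _)) /=.
by rewrite pair_bigA; apply: eq_bigr => [[i j]] /= _; rewrite !mxE !mxvecE.
Qed.

Lemma mxtrace_mul_eq0 N (A : 'M[C]_N) : (forall X, \tr (X *m A) = 0) -> A = 0.
Proof.
move=> trA; apply/matrixP => i j; rewrite mxE -(trA (delta_mx j i)) mxtrace_mulC.
rewrite /mxtrace (bigD1 i) //= big1 ?addr0 => [|a ai]; rewrite mxE.
  rewrite (bigD1 j) //= big1 ?addr0 => [|b bj]; rewrite mxE.
    by rewrite !eqxx mulr1.
  by rewrite (negPf bj) mulr0.
by rewrite big1 // => b _; rewrite mxE (negPf ai) andbF mulr0.
Qed.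

(* Scott's lemma: when the [q.1] are the operators [g_i - 1] of a representation
   and the [q.2] its partial products, [v] is an invariant vector and [w] an
   invariant linear form. *)
Lemma scott_bound n (s : seq ('M[C]_n * 'M[C]_n)) (T : 'M[C]_n) :
    \sum_(q <- s) q.1 *m q.2 = T ->
    (\sum_(q <- s) \rank q.1 + \rank T < n.*2)%N ->
  (exists2 v : 'rV_n, v != 0 & forall q, q \in s -> v *m q.1 = 0) \/
  (exists2 w : 'cV_n, w != 0 &
     T *m w = 0 /\ forall q, q \in s -> q.1 *m q.2 *m w = 0).
Proof.
move=> sumT ltn; pose q (i : 'I_(size s)) := tnth (in_tuple s) i.
(* The product [A *m D *m B] is the sum of the [q.1 *m q.2] minus [T], hence zero. By Frobenius's
   inequality the ranks of [A *m D] and [D *m B] then add up to at most the rank of [D], which is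
   below [2n], so one of them is below [n]. A left kernel vector of [A *m D] gives [v], a right one
   of [D *m B] gives [w]. *)
pose A := row_mx (\mxrow_(i < size s) (1%:M : 'M[C]_n)) (1%:M : 'M[C]_n).
pose D := block_mx (\mxdiag_(i < size s) (q i).1) 0 0 T.
pose B := col_mx (\mxcol_(i < size s) (q i).2) (- (1%:M : 'M[C]_n)).
have AD : A *m D = row_mx (\mxrow_i (q i).1) T.
  rewrite mul_row_block !mulmx0 addr0 add0r mul1mx mul_mxrow_mxdiag.
  by under eq_mxrow do rewrite mul1mx.
have DB : D *m B = col_mx (\mxcol_i ((q i).1 *m (q i).2)) (- T).
  by rewrite mul_block_col !mul0mx addr0 add0r mulmxN mulmx1 mul_mxdiag_mxcol.
have ADB : A *m D *m B = 0.
  rewrite AD mul_row_col mulmxN mulmx1 mul_mxrow_mxcol -sumT.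
  by rewrite [X in _ - X]big_tnth subrr.
have := mxrank_Frobenius A D B; rewrite ADB mxrank0 addn0 rank_diag_block_mx.
rewrite rank_mxdiag => le_rk.
have {ltn} : (\sum_i \rank (q i).1 + \rank T < n.*2)%N.
  by move: ltn; rewrite [X in (X + _ < _)%N]big_tnth.
move=> ltn.
have {le_rk} : (\rank (A *m D) < n)%N || (\rank (D *m B) < n)%N.
  have := leq_ltn_trans le_rk ltn; rewrite -addnn.
  case: (ltnP (\rank (A *m D)) n) => //= le1.
  by case: (ltnP (\rank (D *m B)) n) => // le2; rewrite ltnNge leq_add.
have mem_q p : p \in s -> exists i, p = q i.
  by move=> /(tnthP (in_tuple s)).
case/orP=> lt_rk; [left | right].
  have : ~~ row_free (A *m D) by rewrite /row_free neq_ltn lt_rk.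
  rewrite -kermx_eq0 => /rowV0Pn[v /sub_kermxP vAD v0]; exists v => // _ /mem_q[i ->].
  move: vAD; rewrite AD mul_mx_row mul_mxrow => /eqP; rewrite row_mx_eq0 => /andP[/eqP + _].
  by move=> /(congr1 (fun M => submxrow M i)); rewrite mxrowK submxrow0.
have : ~~ row_free (D *m B)^T by rewrite /row_free mxrank_tr neq_ltn lt_rk.
rewrite -kermx_eq0 => /rowV0Pn[v /sub_kermxP vDB v0].
have {vDB} : D *m B *m v^T = 0 by rewrite -[LHS]trmxK trmx_mul trmxK vDB trmx0.
rewrite DB mul_col_mx mxcol_mul => /eqP; rewrite col_mx_eq0 => /andP[/eqP DBv /eqP Tv].
exists v^T; first by rewrite trmx_eq0.
split; first by apply/eqP; rewrite -oppr_eq0 -mulNmx Tv.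
move=> _ /mem_q[i ->].
by move: DBv => /(congr1 (fun M => submxcol M i)); rewrite mxcolK submxcol0.
Qed.

Variable N : nat.
Implicit Types h : 'M[C]_N * 'M[C]_N.

(* The operator X |-> g' X - X g on intertwiners, for h = (g, g'). *)
Definition intertwine h : 'M[C]_(N * N) := lin_mulmx h.2 - lin_mulmxr h.1.

Lemma mul_intertwine h X :
  mxvec X *m intertwine h = mxvec (h.2 *m X - X *m h.1).
Proof. by rewrite mulmxBr !mul_vec_lin /= linearB. Qed.

(* Fox calculus: the Leibniz rule writes [intertwine] of the product of the
   [h_i] as the sum of the products [q.1 *m q.2]. *)
Fixpoint fox (s : seq ('M[C]_N * 'M[C]_N)) :=
  if s is h :: t then
    (intertwine h, lin_mulmxr (\prod_(p <- t) p.1)) ::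
      [seq (q.1, q.2 *m lin_mulmx h.2) | q <- fox t]
  else [::].

Lemma row_mxvecP (A B : 'M[C]_(N * N)) :
  (forall X, mxvec X *m A = mxvec X *m B) -> A = B.
Proof.
by move=> AB; apply/row_matrixP => i; rewrite !rowE -[delta_mx 0 i]vec_mxK AB.
Qed.

(** Telescoping: with [P] and [P'] the products over the tail, h.2 (P' X - X P) + (h.2 X - X h.1) P
    = h.2 P' X - X h.1 P. *)
Lemma sum_fox s :
  \sum_(q <- fox s) q.1 *m q.2 =
    intertwine (\prod_(p <- s) p.1, \prod_(p <- s) p.2).
Proof.
elim: s => [|h t IHt] /=.
  rewrite !big_nil; apply: row_mxvecP => X.
  by rewrite mulmx0 mul_intertwine mul1mx mulmx1 subrr linear0.
rewrite !big_cons big_map /=; under [X in _ + X]eq_bigr do rewrite mulmxA.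
rewrite -mulmx_suml IHt; apply: row_mxvecP => X.
rewrite mulmxDr !mulmxA !mul_intertwine !mul_vec_lin /= -linearD /=; congr mxvec.
by rewrite mulmxBl mulmxBr -!mulmxE !mulmxA addrC addrA subrK.
Qed.

Lemma fox_dual s Y :
    (forall q, q \in fox s -> forall X Z, mxvec X *m q.1 *m q.2 = mxvec Z ->
       \tr (Z *m Y) = 0) ->
    \prod_(p <- s) p.1 *m Y = Y *m \prod_(p <- s) p.2 ->
  forall h, h \in s ->
    h.1 *m (Y *m \prod_(p <- s) p.2) = Y *m \prod_(p <- s) p.2 *m h.2.
Proof.
elim: s Y => [|h t IHt] //= Y foxY; rewrite !big_cons -!mulmxE => PY.
set P := \prod_(p <- t) p.1 in foxY PY *; set P' := \prod_(p <- t) p.2 in foxY PY *.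
have PYh : P *m Y *m h.2 = h.1 *m P *m Y.
  apply/eqP; rewrite -subr_eq0; apply/eqP/mxtrace_mul_eq0 => X.
  have := foxY _ (mem_head _ _) X ((h.2 *m X - X *m h.1) *m P); rewrite /=.
  rewrite mul_intertwine mul_vec_lin => /(_ erefl) <-.
  rewrite !mulmxBr !mulmxBl !raddfB /= !mulmxA; congr (_ - _).
  by rewrite mxtrace_mulC !mulmxA.
move=> a; rewrite inE => /orP[/eqP->|at_].
  by rewrite -PY -[in LHS]PYh !mulmxA.
have := IHt (Y *m h.2) _ _ a at_; rewrite !mulmxA; apply; last by rewrite PYh PY mulmxA.
move=> q qt X Z XZ; rewrite mulmxA mxtrace_mulC mulmxA.
apply: (foxY (q.1, q.2 *m lin_mulmx h.2) _ X).
  by rewrite inE; apply/orP; right; apply/mapP; exists q.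
by rewrite /= mulmxA XZ mul_vec_lin.
Qed.

(* The rank condition says that the Euler characteristic of the local system
   Hom(g, g') on the punctured sphere is positive, so it has a nonzero H^0 or H^2;
   the latter is dual to the H^0 of Hom(g', g). *)
Lemma katz_intertwiner s :
    (forall h, h \in s -> h.2 \in unitmx) ->
    (\sum_(h <- s) \rank (intertwine h)
      + \rank (intertwine (\prod_(h <- s) h.1, \prod_(h <- s) h.2)%R) < (N * N).*2)%N ->
  (exists2 X : 'M[C]_N, X != 0 & forall h, h \in s -> h.2 *m X = X *m h.1) \/
  (exists2 Y : 'M[C]_N, Y != 0 & forall h, h \in s -> h.1 *m Y = Y *m h.2).
Proof.
move=> s_unit lt_rk.
have rk_fox : (\sum_(q <- fox s) \rank q.1 = \sum_(h <- s) \rank (intertwine h))%N.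
  elim: (s) => [|h t IHt] /=; first by rewrite !big_nil.
  by rewrite !big_cons big_map /= IHt.
have mem_fox h : h \in s -> exists2 q, q \in fox s & q.1 = intertwine h.
  elim: (s) => //= a t IHt; rewrite inE => /orP[/eqP->|/IHt[q qt <-]].
    by eexists; first exact: mem_head.
  exists (q.1, q.2 *m lin_mulmx a.2) => //.
  by rewrite inE; apply/orP; right; apply/mapP; exists q.
rewrite -rk_fox in lt_rk.
case: (scott_bound (sum_fox s) lt_rk) => [[v v0 vfox]|[w w0 [Tw wfox]]].
  left; exists (vec_mx v); first by rewrite vec_mx_eq0.
  move=> h /mem_fox[q /vfox + qh]; rewrite qh -{1}[v]vec_mxK mul_intertwine => /eqP.
  by rewrite mxvec_eq0 subr_eq0 => /eqP.
(* [Y] represents the linear form [w]. The intertwiner will be [Y *m P'], which is nonzero because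
   [P'] is invertible. *)
pose Y := (vec_mx w^T)^T.
have trY Z : mxvec Z *m w = (\tr (Z *m Y))%:M.
  by rewrite -mxvec_mxtrace vec_mxK trmxK.
have trY0 Z : mxvec Z *m w = 0 -> \tr (Z *m Y) = 0.
  by rewrite trY => /(congr1 (fun M : 'M[C]_1 => M 0 0)); rewrite !mxE mulr1n.
set P := \prod_(h <- s) h.1 in Tw *; set P' := \prod_(h <- s) h.2 in Tw *.
have PY : P *m Y = Y *m P'.
  apply/eqP; rewrite eq_sym -subr_eq0; apply/eqP/mxtrace_mul_eq0 => X.
  have /trY0 <- : mxvec (P' *m X - X *m P) *m w = 0.
    by rewrite -(mul_intertwine (P, P')) -mulmxA Tw mulmx0.
  rewrite mulmxBr mulmxBl !raddfB /= !mulmxA; congr (_ - _).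
  by rewrite mxtrace_mulC !mulmxA.
right; exists (Y *m P').
  have P'u : P' \in unitmx.
    rewrite /P' big_seq; elim/big_ind: _ => [|A B Au Bu|h /s_unit //].
      exact: unitmx1.
    by rewrite -mulmxE unitmx_mul Au.
  apply: contraNneq w0 => /(congr1 (mulmx^~ (invmx P'))); rewrite mulmxK // mul0mx.
  by move=> /eqP; rewrite trmx_eq0 vec_mx_eq0 trmx_eq0.
apply: fox_dual => // q /wfox qw X Z XZ; apply: trY0.
by rewrite -XZ -!mulmxA (mulmxA q.1) qw mulmx0.
Qed.

(** The map X |-> A X B factors through matrices with [\rank A] rows and [\rank B] columns. *)
Lemma rank_lin_mulmx_mulmxr (A B : 'M[C]_N) :
  (\rank (lin_mulmx A *m lin_mulmxr B) <= \rank A * \rank B)%N.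
Proof.
have -> : lin_mulmx A *m lin_mulmxr B =
    lin_mulmx (row_base A) *m lin_mulmxr (col_base B) *m
    (lin_mulmx (col_base A) *m lin_mulmxr (row_base B)) :> 'M[C]_(N * N).
  apply: row_mxvecP => X; rewrite !mulmxA !mul_vec_lin /=; congr mxvec.
  by rewrite -[A in LHS]mulmx_base -[B in LHS]mulmx_base !mulmxA.
exact: leq_trans (mxrankM_maxl _ _) (rank_leq_col _).
Qed.

(** With the spectral projections [P a] of [h.1], h.2 X - X h.1 is the sum of the (h.2 - x a) X (P
    a), and each term has rank at most (N - m a) m a. The total is the dimension of the conjugacy
    class of [h.1] when the [x a] are distinct. *)
Lemma rank_intertwine p (x : 'I_p -> C) (m : 'I_p -> nat) h :
    conjugate h.1 (scalar_blocks x m) ->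
    (forall a, \rank (h.2 - (x a)%:M)%R + m a <= N)%N ->
  (\rank (intertwine h) <= \sum_a m a * (N - m a))%N.
Proof.
move=> ch rk_h; have [P [sumP hP rkP]] := spectral_projections ch.
have -> : intertwine h = \sum_a lin_mulmx (h.2 - (x a)%:M) *m lin_mulmxr (P a).
  apply: row_mxvecP => X; rewrite mul_intertwine mulmx_sumr.
  under eq_bigr => a _ do rewrite mulmxA !mul_vec_lin /=.
  rewrite -linear_sum /=; congr mxvec.
  under eq_bigr => a _ do
    rewrite mulmxBl mul_scalar_mx mulmxBl -scalemxAl scalemxAr -hP.
  by rewrite sumrB -mulmx_sumr -[in X in _ = _ - X]mulmx_sumr -mulmx_sumr sumP !mulmx1.
elim/big_ind2: _ => [|A a B b leA leB|a _]; first by rewrite mxrank0.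
  exact: leq_trans (mxrank_add _ _) (leq_add leA leB).
apply: leq_trans (rank_lin_mulmx_mulmxr _ _) _.
rewrite rkP mulnC leq_mul2l leq_subRL; last by rewrite -(rkP a) rank_leq_row.
by rewrite addnC rk_h orbT.
Qed.

End Rigidity.

(** * Rank one updates and irreducibility *)

Section RankOneUpdates.
Variable C : fieldType.

Lemma codim_fixedE N (M : 'M[C]_N) : codim_fixed M = \rank (M - 1%:M).
Proof. by rewrite /codim_fixed mxrank_ker mxrank_tr subKn ?rank_leq_row. Qed.

Lemma conjugate_det N N' (M : 'M[C]_N) (M' : 'M[C]_N') :
  conjugate M M' -> \det M = \det M'.
Proof.
move=> cM; have e := conjugate_dim cM; subst N'.
have /conjugate_square[P Pu PM] := cM.
apply: (mulfI (_ : \det P != 0)); first by rewrite -unitfE -unitmxE.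
by rewrite -det_mulmx PM det_mulmx mulrC.
Qed.

(** Matrix determinant lemma: the bordered matrix [A] is factored through either of its two Schur
    complements. *)
Lemma det_rank1_update N (w : 'cV[C]_N) (z : 'rV[C]_N) :
  \det (1%:M + w *m z) = 1 + (z *m w) 0 0.
Proof.
pose A : 'M[C]_(1 + N) := block_mx 1%:M (- z) w 1%:M.
have A1 : A = block_mx 1%:M 0 w 1%:M *m block_mx 1%:M (- z) 0 (1%:M + w *m z).
  rewrite mulmx_block !(mul1mx, mulmx1, mul0mx, mulmx0, addr0, add0r) mulmxN.
  by rewrite [1%:M + _]addrC addKr.
have A2 : A = block_mx (1%:M + z *m w) (- z) 0 1%:M *m block_mx 1%:M 0 w 1%:M.
  rewrite mulmx_block !(mul1mx, mulmx1, mul0mx, mulmx0, addr0, add0r) mulNmx.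
  by rewrite addrK.
have := congr1 determinant A1; rewrite {}A2 !det_mulmx !(det_ublock, det_lblock).
rewrite !det1 !(mul1r, mulr1) => <-.
by rewrite det_mx11 !mxE mulr1n.
Qed.

(** Padding by [pid_mx] brings the inner dimension of the full rank factorization to 1 even when [M]
    is zero. *)
Lemma rank_le1_mul m n (M : 'M[C]_(m, n)) :
  (\rank M <= 1)%N -> exists (w : 'cV_m) (z : 'rV_n), M = w *m z.
Proof.
move=> rkM; exists (col_base M *m pid_mx (\rank M)), (pid_mx (\rank M) *m row_base M).
rewrite mulmxA -(mulmxA (col_base M)) mul_pid_mx minnn (minn_idPr rkM) pid_mx_1.
by rewrite mulmx1 mulmx_base.
Qed.

(** Write M = mu + w z. Its determinant is mu^(N-1) (mu + z w), so eta = mu + z w, and [w] is an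
    eigenvector for this value; if w = 0 then eta = mu and [M] is scalar. *)
Lemma rank1_eigenvalue N (M : 'M[C]_N) (mu eta : C) :
    (0 < N)%N -> mu != 0 -> (\rank (M - mu%:M)%R <= 1)%N ->
    \det M = mu ^+ N.-1 * eta ->
  (\rank (M - eta%:M)%R + 1 <= N)%N.
Proof.
move=> N0 mu0 /rank_le1_mul[w [z Mwz]].
have -> : M = mu *: (1%:M + (mu^-1 *: w) *m z).
  by rewrite scalerDr -scalemxAl scalerA mulfV // scale1r scalemx1 -Mwz addrC subrK.
rewrite detZ det_rank1_update -scalemxAr mxE -{1}(prednK N0) exprSr -mulrA.
move=> /(mulfI (expf_neq0 _ mu0)); rewrite mulrDr mulr1 mulrA mulfV // mul1r => <-.
rewrite scalerDr -scalemxAl scalerA mulfV // scale1r scalemx1.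
have [->|w0] := eqVneq w 0.
  by rewrite mul0mx mulmx0 mxE !addr0 subrr mxrank0.
set t := mu + _; have Mw : (mu%:M + w *m z - t%:M) *m w = 0.
  rewrite mulmxBl mulmxDl -mulmxA [z *m w]mx11_scalar mul_mx_scalar !mul_scalar_mx.
  by rewrite -scalerDl subrr.
apply: leq_trans (mulmx0_rank_max Mw).
by rewrite leq_add2l lt0n mxrank_eq0.
Qed.

Lemma pseudo_reflection_rank N (M : 'M[C]_N) lambda :
    pseudo_reflection M lambda ->
  (\rank (M - 1%:M)%R <= 1)%N /\ (\rank (M - lambda%:M)%R + 1 <= N)%N.
Proof.
move=> [_ + detM _]; rewrite codim_fixedE => rkM; rewrite rkM; split=> //.
apply: (@rank1_eigenvalue _ _ 1); rewrite ?oner_neq0 ?rkM //.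
  by rewrite -rkM rank_leq_row.
by rewrite expr1n mul1r.
Qed.

Definition two T (a b : T) (i : 'I_2) : T := if i == 0 then a else b.

Lemma two_inj (T : eqType) (a b : T) : a != b -> injective (two a b).
Proof.
move=> ab i j; rewrite /two; case: (unliftP 0 i) => [i'|] ->; case: (unliftP 0 j) => [j'|] -> //=.
- by rewrite (ord1 i') (ord1 j').
- by move=> e; rewrite e eqxx in ab.
- by move=> e; rewrite e eqxx in ab.
Qed.

Lemma conjugate_two N (M : 'M[C]_N) (a b : C) (p q : nat) :
    a != b -> (p + q = N)%N ->
    (\rank (M - a%:M)%R + p <= N)%N -> (\rank (M - b%:M)%R + q <= N)%N ->
  conjugate M (scalar_blocks (two a b) (two p q)).
Proof.
move=> ab pq rka rkb; apply: conjugate_scalar_blocks; first exact: two_inj.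
  by rewrite big_ord_recl big_ord1.
by move=> i; rewrite /two; case: ifP.
Qed.

Lemma rank_intertwine_two N (h : 'M[C]_N * 'M[C]_N) (a b : C) (p q : nat) :
    a != b -> (p + q = N)%N ->
    (\rank (h.1 - a%:M)%R + p <= N)%N -> (\rank (h.1 - b%:M)%R + q <= N)%N ->
    (\rank (h.2 - a%:M)%R + p <= N)%N -> (\rank (h.2 - b%:M)%R + q <= N)%N ->
  (\rank (intertwine h) <= (p * q).*2)%N.
Proof.
move=> ab pq rk1a rk1b rk2a rk2b.
apply: leq_trans (rank_intertwine (conjugate_two ab pq rk1a rk1b) _) _.
  by move=> i; rewrite /two; case: ifP.
by rewrite big_ord_recl big_ord1 /= -pq addKn addnK -addnn [(q * p)%N]mulnC.
Qed.

Lemma rank_intertwine_reflection N (h : 'M[C]_N * 'M[C]_N) (lambda : C) :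
    lambda != 1 ->
    (\rank (h.1 - 1%:M)%R <= 1)%N -> (\rank (h.1 - lambda%:M)%R + 1 <= N)%N ->
    (\rank (h.2 - 1%:M)%R <= 1)%N -> (\rank (h.2 - lambda%:M)%R + 1 <= N)%N ->
  (\rank (intertwine h) <= N.-1.*2)%N.
Proof.
move=> lambda1 rk11 rk1l rk21 rk2l.
have N0 : (0 < N)%N by apply: leq_trans rk1l; rewrite addn1.
have N1 : (1 + N.-1 = N)%N by rewrite add1n prednK.
rewrite -[N.-1]mul1n; apply: (rank_intertwine_two lambda1 N1) => //.
  by rewrite -[leqRHS]N1 leq_add2r.
by rewrite -[leqRHS]N1 leq_add2r.
Qed.

Lemma rank_prod_sub1 N (I : Type) (s : seq I) (A : I -> 'M[C]_N) :
  (\rank (\prod_(i <- s) A i - 1%:M)%R <= \sum_(i <- s) \rank (A i - 1%:M)%R)%N.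
Proof.
elim: s => [|i s IHs]; first by rewrite !big_nil subrr mxrank0.
rewrite !big_cons; set B := \prod_(j <- s) _ in IHs *.
have -> : A i * B - 1%:M = (A i - 1%:M) *m B + (B - 1%:M).
  by rewrite mulmxBl mul1mx addrA subrK.
apply: leq_trans (mxrank_add _ _) (leq_add _ IHs).
exact: mxrankM_maxl.
Qed.

(** Sylvester's inequality, iterated: nullities are subadditive under products. *)
Lemma rank_prod_ge N (I : Type) (s : seq I) (A : I -> 'M[C]_N) :
  (N <= \rank (\prod_(i <- s) A i)%R + \sum_(i <- s) (N - \rank (A i)))%N.
Proof.
elim: s => [|i s IHs]; first by rewrite !big_nil mxrank1 leq_addr.
rewrite !big_cons; set B := \prod_(j <- s) _ in IHs *.
have := mxrank_mul_min (A i) B; rewrite -mulmxE.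
have := rank_leq_row (A i); have := rank_leq_row B.
move: IHs; move: (\rank _) (\rank _) (\rank _) (\sum_(j <- s) _)%N => a b c d.
lia.
Qed.

End RankOneUpdates.

(** * Schur's lemma and two criteria for trivial stable subspaces *)

Section Irreducibility.
Variables (C : fieldType) (I : Type) (N : nat).

(** The kernel of [X] and the image of [Y] are both subrepresentations of [g]. Irreducibility of [g]
    therefore makes [X] injective or [Y] surjective, and these matrices are square. *)
Lemma irreducible_rep_iso (g g' : I -> 'M[C]_N) :
    irreducible (Rep g) ->
    (exists2 X : 'M_N, X != 0 & forall i, g' i *m X = X *m g i) \/
    (exists2 Y : 'M_N, Y != 0 & forall i, g i *m Y = Y *m g' i) ->
  rep_iso (Rep g) (Rep g').
Proof.
move=> [_ irr] [[X X0 Xg]|[Y Y0 Yg]].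
  have stK i : stablemx (kermx X^T) (g i)^T.
    by rewrite sub_kermx -mulmxA -trmx_mul -Xg trmx_mul mulmxA mulmx_ker mul0mx.
  have Xfree : row_free X^T.
    case: (irr _ stK) => [/eqP|K_full]; first by rewrite kermx_eq0.
    have : (1%:M <= kermx X^T)%MS by rewrite sub1mx.
    by rewrite sub_kermx mul1mx trmx_eq0 (negPf X0).
  have Xu : X \in unitmx by rewrite -unitmx_tr -row_free_unit.
  by exists X; split; rewrite ?row_free_unit ?row_full_unit.
have stY i : stablemx Y^T (g i)^T.
  by rewrite -trmx_mul Yg trmx_mul submxMl.
have Yu : Y \in unitmx.
  case: (irr _ stY) => [/eqP|]; first by rewrite trmx_eq0 (negPf Y0).
  by rewrite row_full_unit unitmx_tr.
exists (invmx Y); rewrite ?row_free_unit ?row_full_unit ?unitmx_inv; split=> // i.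
by rewrite /= -[g i in LHS](mulmxK Yu) Yg !mulmxA mulVmx ?mul1mx.
Qed.

(** On [S] all powers of [V] and [V0] agree, so [V ^+ k - e%:M] is zero there while being
    invertible. *)
Lemma stable_eq0 k e p (S : 'M[C]_(p, N)) (V V0 : 'M[C]_N) :
    stablemx S V -> S *m V0 = S *m V -> V0 ^+ k = e%:M -> V ^+ k - e%:M \in unitmx ->
  S = 0.
Proof.
move=> SV SV0 V0k Vk.
have SVn n : (S *m V ^+ n <= S)%MS /\ S *m V0 ^+ n = S *m V ^+ n.
  elim: n => [|n [IHs IHe]]; first by rewrite !expr0 mulmx1; split.
  rewrite !exprSr -!mulmxE !mulmxA IHe; split.
    exact: submx_trans (submxMr _ IHs) SV.
  by have /submxP[K ->] := IHs; rewrite -!mulmxA SV0.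
have : S *m (V ^+ k - e%:M) = 0 by rewrite mulmxBr -V0k; case: (SVn k) => _ ->; rewrite subrr.
by move=> /(congr1 (mulmx^~ (invmx (V ^+ k - e%:M)))); rewrite mulmxK // mul0mx.
Qed.

Variables (k : nat) (e : C) (A W W0 : 'M[C]_N).
Hypotheses (AW : A *m W = W0) (W0k : W0 ^+ k = e%:M) (Wk : W ^+ k - e%:M \in unitmx).

Let trX (M : 'M[C]_N) n : (M ^+ n)^T = M^T ^+ n.
Proof. by elim: n => [|n IHn]; rewrite ?trmx1 // exprS exprSr -!mulmxE trmx_mul IHn. Qed.

(** Where [A] acts trivially, [W0] and [W] agree. *)
Lemma stable_fixed_eq0 p (S : 'M[C]_(p, N)) :
  stablemx S W^T -> S *m (A - 1%:M)^T = 0 -> S = 0.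
Proof.
move=> SW SA; apply: (@stable_eq0 k e p S W^T W0^T) => //.
- rewrite -AW trmx_mul mulmxA; have /submxP[K ->] := SW; rewrite -mulmxA.
  congr (_ *m _); apply/eqP; rewrite -subr_eq0 -{2}[S]mulmx1 -mulmxBr.
  by rewrite -trmx1 -raddfB /= SA.
- by rewrite -trX W0k tr_scalar_mx.
- by rewrite -trX -[e%:M]tr_scalar_mx -raddfB /= unitmx_tr.
Qed.

(** Dual of [stable_fixed_eq0]: as [S] contains the image of [A - 1%:M], [A] acts trivially on the
    quotient by [S], and the argument applies to the annihilator [kermx S^T]. *)
Lemma stable_full p (S : 'M[C]_(p, N)) :
  stablemx S W^T -> ((A - 1%:M)^T <= S)%MS -> row_full S.
Proof.
move=> SW SA; suff /eqP : kermx S^T = 0 by rewrite kermx_eq0 /row_free mxrank_tr.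
apply: (@stable_eq0 k e _ _ W W0) => //.
- have /submxP[K SK] := SW; rewrite sub_kermx -mulmxA -[W]trmxK -trmx_mul SK.
  by rewrite trmx_mul mulmxA mulmx_ker mul0mx.
- have /submxP[K SK] := SA; rewrite -AW mulmxA; congr (_ *m _).
  apply/eqP; rewrite -subr_eq0 -{2}[kermx _]mulmx1 -mulmxBr.
  by rewrite -[A - _]trmxK SK trmx_mul mulmxA mulmx_ker mul0mx.
Qed.

End Irreducibility.

(** * Rigidity on the turbine *)

Section Roots.

Lemma scalar_mxX (C : fieldType) N (a : C) n : (a%:M : 'M_N) ^+ n = (a ^+ n)%:M.
Proof.
elim: n => [|n IHn]; first by rewrite !expr0.
by rewrite !exprS IHn -mulmxE -scalar_mxM.
Qed.

Lemma mxpowz_scalar (C : fieldType) N (a : C) (z : int) :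
  mxpowz (a%:M : 'M_N) z = (a ^ z)%:M.
Proof.
case: z => n; rewrite /= ?invmx_scalar ?scalar_mxX //.
by rewrite exprVn.
Qed.

Lemma horner_prod_mx (C : fieldType) N (M : 'M[C]_N) k e (zeta : 'I_k -> C) :
    'X^k - e%:P = \prod_j ('X - (zeta j)%:P) ->
  M ^+ k - e%:M = \prod_j (M - (zeta j)%:M).
Proof.
case: N M => [|N] M; first by move=> _; rewrite [LHS]flatmx0 [RHS]flatmx0.
move=> /(congr1 (horner_mx M)).
rewrite rmorphB rmorphXn /= horner_mx_X horner_mx_C rmorph_prod => ->.
by apply: eq_bigr => j _; rewrite rmorphB /= horner_mx_X horner_mx_C.
Qed.

(** Since [k] and [e] are nonzero in [C], the polynomial is coprime to its derivative, so its [k]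
    roots are distinct. *)
Lemma exists_roots (C : closedFieldType) k (e : C) :
    (0 < k)%N -> k%:R != 0 :> C -> e != 0 ->
  exists zeta : 'I_k -> C,
    [/\ injective zeta, forall z, z ^+ k = e <-> exists j, zeta j = z &
        'X^k - e%:P = \prod_j ('X - (zeta j)%:P)].
Proof.
move=> k0 kC0 e0; pose p : {poly C} := 'X^k - e%:P.
have sz_p : size p = k.+1 by rewrite size_XnsubC.
have [s ps] := closed_field_poly_normal p.
have lc1 : lead_coef p = 1 by apply/monicP/monicXnsubC.
rewrite lc1 scale1r in ps.
have sz_s : size s = k by apply: succn_inj; rewrite -sz_p ps size_prod_XsubC.
have root_p z : root p z = (z ^+ k == e).
  by rewrite rootE !hornerE subr_eq0.
have uniq_s : uniq s.
  rewrite -separable_prod_XsubC -ps unlock.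
  rewrite derivB derivXn derivC subr0 -scaler_nat coprimepZr //.
  by rewrite coprimep_expr // coprimepX root_p expr0n gtn_eqF // eq_sym.
exists (fun j => s`_j); split.
- move=> i j /eqP; rewrite nth_uniq ?sz_s // => /eqP; exact: val_inj.
- move=> z; rewrite (rwP eqP) -root_p ps root_prod_XsubC; split=> [zs|[j <-]].
    have lt_k : (index z s < k)%N by rewrite -sz_s index_mem.
    by exists (Ordinal lt_k); rewrite /= nth_index.
  by rewrite mem_nth ?sz_s.
- by rewrite -/p ps (big_nth 0) big_mkord sz_s.
Qed.

End Roots.

Section TurbineRigidity.
Variables (C : fieldType) (k : nat) (r : int) (l : nat) (eps : C) (zeta : 'I_k -> C).
Hypotheses (zeta_inj : injective zeta).
Hypothesis zetaE : 'X^k - (eps ^ r)%:P = \prod_j ('X - (zeta j)%:P).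

Lemma root_zeta j : zeta j ^+ k = eps ^ r.
Proof.
have := congr1 (horner^~ (zeta j)) zetaE; rewrite /= !hornerE horner_prod.
rewrite [RHS](bigD1 j) //= !hornerE subrr mul0r => /eqP.
by rewrite subr_eq0 => /eqP.
Qed.

Lemma omega_inf_unit N (W : 'M[C]_N) :
  (forall j, W - (zeta j)%:M \in unitmx) -> W ^+ k - (eps ^ r)%:M \in unitmx.
Proof.
move=> Wu; rewrite (horner_prod_mx W zetaE).
elim/big_ind: _ => [|A B Au Bu|j _ //]; first exact: unitmx1.
by rewrite -mulmxE unitmx_mul Au.
Qed.

Section System.
Variable L : rep C (turbine_gen l).
Hypothesis Lsys : turbine_local_system k r L.
Hypothesis Leps : L Delta = eps%:M.

Lemma omega0_pow : L Omega0 ^+ k = (eps ^ r)%:M.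
Proof. by have [_ _ _ ->] := Lsys; rewrite Leps mxpowz_scalar. Qed.

(** With [A] the product of the [alpha_i], A (omega_inf - zeta) = (omega_0 - zeta) - zeta (A - 1),
    where the left side is invertible and A - 1 has rank at most [l]. Each nullity [d j] is thus at
    most [l]. The product of the omega_0 - zeta_j vanishes, so the [d j] add up to at least [k * l],
    which forces equality everywhere. *)
Lemma omega0_rank j :
    rk L = (k * l)%N ->
    (forall i, \rank (L (Alpha i) - 1%:M)%R <= 1)%N ->
    (forall j, L Omega_inf - (zeta j)%:M \in unitmx) ->
  (\rank (L Omega0 - (zeta j)%:M)%R + l = rk L)%N.
Proof.
move=> rkL rkA Wu; pose d j := (rk L - \rank (L Omega0 - (zeta j)%:M)%R)%N.
have le_d i : (d i <= l)%N.
  rewrite leq_subLR; have rkW : (rk L <= \rank (L Omega_inf - (zeta i)%:M)%R)%N.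
    by have := Wu i; rewrite -row_free_unit => /eqP ->.
  apply: leq_trans rkW _.
  pose A := \prod_(i < l) L (Alpha i).
  have Au : row_full A.
    rewrite row_full_unit /A; elim/big_ind: _ => [|X Y Xu Yu|a _].
    - exact: unitmx1.
    - by rewrite -mulmxE unitmx_mul Xu.
    - by case: Lsys.
  rewrite -(eqmxMfull _ Au) mulmxBr; have [_ -> _ _] := Lsys.
  have -> : L Omega0 - A *m (zeta i)%:M =
      (L Omega0 - (zeta i)%:M) + (- zeta i) *: (A - 1%:M).
    rewrite mul_mx_scalar scaleNr scalerBr scalemx1 opprB addrA.
    by rewrite subrK.
  apply: leq_trans (mxrank_add _ _) _; rewrite leq_add2l.
  apply: leq_trans (mxrank_scale _ _) _; apply: leq_trans (rank_prod_sub1 _ _) _.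
  by rewrite -[leqRHS]card_ord -sum1_card leq_sum.
have sum_d : (k * l <= \sum_j d j)%N.
  have := rank_prod_ge (index_enum 'I_k) (fun j => L Omega0 - (zeta j)%:M).
  by rewrite -(horner_prod_mx _ zetaE) omega0_pow subrr mxrank0 add0n -rkL.
have dj : d j = l.
  apply/eqP; rewrite eqn_leq le_d /= leqNgt; apply/negP => lt_l.
  move: sum_d; rewrite leqNgt (bigD1 j) //= => /negP; apply.
  have : (\sum_(i < k | i != j) d i <= \sum_(i < k | i != j) l)%N by apply: leq_sum.
  rewrite sum_nat_const cardC1 card_ord => le_s.
  have k0 := leq_ltn_trans (leq0n j) (ltn_ord j).
  by rewrite -[k in (_ < k * l)%N](prednK k0) mulSn -addSn leq_add.
by have := subnKC (rank_leq_row (L Omega0 - (zeta j)%:M)); rewrite -/(d j) dj.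
Qed.

End System.

(** Local data weakened to upper bounds on ranks, a form that can be read off directly from a
    quotient or a direct sum. *)
Definition rank_data (L : rep C (turbine_gen l)) (lambda : 'I_l -> C) nu
    (x : 'I_nu -> C) (m : 'I_nu -> nat) : Prop :=
  [/\ L Delta = eps%:M,
      forall i, (\rank (L (Alpha i) - 1%:M)%R <= 1)%N /\
        (\rank (L (Alpha i) - (lambda i)%:M)%R + 1 <= rk L)%N &
      forall a, (\rank (L Omega_inf - (x a)%:M)%R + m a <= rk L)%N].

(** With N = k l, the operators [intertwine] have rank at most 2 (N - 1) for each [alpha_i], N^2 -
    sum m_a^2 for [omega_inf] and N^2 - k l^2 for [omega_0]. The numerical hypothesis on the [m a]
    says exactly that these bounds add up to less than 2 N^2. *)
Lemma turbine_unique (L L' : rep C (turbine_gen l)) (lambda : 'I_l -> C) nu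
    (x : 'I_nu -> C) (m : 'I_nu -> nat) :
    turbine_local_system k r L -> turbine_local_system k r L' ->
    irreducible L -> rk L' = rk L -> rk L = (k * l)%N ->
    rank_data L lambda x m -> rank_data L' lambda x m ->
    (forall i, lambda i != 1) -> injective x -> (\sum_a m a = k * l)%N ->
    (forall a, x a ^+ k != eps ^ r) ->
    (k * l ^ 2 < l.*2 + \sum_a m a ^ 2)%N ->
  rep_iso L L'.
Proof.
case: L' => N g' Lsys Lsys' Lirr /= rkE; subst N; case: L g' Lsys Lsys' Lirr => N g g' /=.
move=> Lsys Lsys' Lirr NE [Leps LA LW] [Leps' LA' LW'] lam1 x_inj sum_m x_eps idx.
move: (Lsys) (Lsys') => [Lu Lrel Lc _] [Lu' Lrel' Lc' _].
rewrite /= in Leps LA LW Lrel Leps' LA' LW' Lrel'.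
have cW : conjugate (g Omega_inf) (scalar_blocks x m).
  by apply: conjugate_scalar_blocks; rewrite ?sum_m.
have cW' : conjugate (g' Omega_inf) (scalar_blocks x m).
  by apply: conjugate_scalar_blocks; rewrite ?sum_m.
have x_zeta a j : x a != zeta j by apply: contraNneq (x_eps a) => ->; rewrite root_zeta.
have Wu j : g Omega_inf - (zeta j)%:M \in unitmx by apply: conjugate_scalar_blocks_unit cW _.
have Wu' j : g' Omega_inf - (zeta j)%:M \in unitmx by apply: conjugate_scalar_blocks_unit cW' _.
have rk0 j := omega0_rank Lsys Leps j NE (fun i => proj1 (LA i)) Wu.
have rk0' j := omega0_rank Lsys' Leps' j NE (fun i => proj1 (LA' i)) Wu'.
rewrite /= in rk0 rk0'.
have c0 : conjugate (g Omega0) (scalar_blocks zeta (fun _ => l)).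
  apply: conjugate_scalar_blocks => // [|j]; last by rewrite rk0.
  by rewrite sum_nat_const card_ord.
(* By the defining relation, the product over this list is the pair of the two [omega_0]. *)
pose s := [seq (g (Alpha i), g' (Alpha i)) | i <- index_enum 'I_l]
  ++ [:: (g Omega_inf, g' Omega_inf)].
have prod1 : \prod_(h <- s) h.1 = g Omega0.
  by rewrite big_cat big_map /= big_seq1 -Lrel.
have prod2 : \prod_(h <- s) h.2 = g' Omega0.
  by rewrite big_cat big_map /= big_seq1 -Lrel'.
have mem_s P : (forall h, h \in s -> P h.1 h.2) ->
    (forall i, P (g (Alpha i)) (g' (Alpha i))) /\ P (g Omega_inf) (g' Omega_inf).
  move=> sP; split=> [i|].
    apply: (sP (g (Alpha i), g' (Alpha i))); rewrite mem_cat; apply/orP; left.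
    by apply/mapP; exists i; rewrite ?mem_index_enum.
  by apply: (sP (g Omega_inf, g' Omega_inf)); rewrite mem_cat mem_head orbT.
apply: irreducible_rep_iso => //.
have lt_rk : (\sum_(h <- s) \rank (intertwine h)
    + \rank (intertwine (\prod_(h <- s) h.1, \prod_(h <- s) h.2)%R) < (N * N).*2)%N.
  rewrite prod1 prod2 big_cat big_map /= big_seq1.
  have le1 : (\sum_(i < l) \rank (intertwine (g (Alpha i), g' (Alpha i))) <= l * N.-1.*2)%N.
    suff le_sum : (\sum_(i < l) \rank (intertwine (g (Alpha i), g' (Alpha i)))
                     <= \sum_(i < l) N.-1.*2)%N.
      by apply: leq_trans le_sum _; rewrite sum_nat_const card_ord.
    apply: leq_sum => i _; have [? ?] := LA i; have [? ?] := LA' i.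
    exact: (rank_intertwine_reflection (lambda := lambda i)).
  have le2 := rank_intertwine (h := (g Omega_inf, g' Omega_inf)) cW LW'.
  have le3 : (\rank (intertwine (g Omega0, g' Omega0)) <= \sum_(j < k) l * (N - l))%N.
    exact: (rank_intertwine (h := (g Omega0, g' Omega0)) c0 (fun j => eq_leq (rk0' j))).
  rewrite sum_nat_const card_ord in le3.
  have sq : (\sum_a m a * (N - m a) + \sum_a m a ^ 2 = N * N)%N.
    have -> : (N * N = (\sum_a m a) * N)%N by rewrite sum_m -NE.
    rewrite -big_split /= big_distrl /=; apply: eq_bigr => a _.
    rewrite -mulnn -mulnDr subnK //.
    by rewrite NE -sum_m (bigD1 a) //= leq_addr.
  have N0 : (0 < N)%N by case: Lirr.
  have lN : (l <= N)%N by move: N0; rewrite NE; case: (k) => // k' _; rewrite mulSn leq_addr.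
  have eq1 : (l * N.-1.*2 + l.*2 = (k * l ^ 2).*2)%N.
    by rewrite -!muln2 mulnA -mulnDl -mulnSr prednK // NE mulnCA -mulnn.
  have eq3 : (k * (l * (N - l)) + k * l ^ 2 = N * N)%N.
    by rewrite -mulnn -mulnDr -mulnDr subnK // mulnA -NE.
  move: le1 le2 le3 sq idx eq1 eq3.
  move: (\rank _) (\rank _) (\sum_(i < l) _)%N => y1 y2 y3.
  move: (\sum_a m a * (N - m a))%N (\sum_a m a ^ 2)%N (k * l ^ 2)%N => S1 S2 x1.
  move: (k * (l * (N - l)))%N (l * N.-1.*2)%N (N * N)%N => x2 x3 x4.
  clear; lia.
have gp h : h \in s -> h.2 \in unitmx.
  by rewrite mem_cat inE => /orP[/mapP[i _ ->]|/eqP->]; apply: Lu'.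
have scal (X : 'M[C]_N) : g Delta *m X = X *m g' Delta.
  by rewrite Leps Leps' scalar_mxC.
have scal' (X : 'M[C]_N) : g' Delta *m X = X *m g Delta.
  by rewrite Leps Leps' scalar_mxC.
have prod_comm (X : 'M[C]_N) (f f' : 'I_l -> 'M[C]_N) :
    (forall i, f i *m X = X *m f' i) -> (\prod_i f i) *m X = X *m \prod_i f' i.
  move=> fX; elim/big_ind2: _ => [|A A' B B' AX BX|i _ //]; first by rewrite mul1mx mulmx1.
  by rewrite -!mulmxE -mulmxA BX !mulmxA AX.
(* A morphism for the [alpha_i] and [omega_inf] is one for [omega_0] by the relation, and for
   [delta] because it is the same scalar on both sides. *)
case: (katz_intertwiner gp lt_rk) => [[X X0 sX]|[X X0 sX]]; [left | right]; exists X => //.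
  have [XA XW] := mem_s (fun A B => B *m X = X *m A) sX.
  case=> [i|||] //; rewrite -Lrel -Lrel' -mulmxA XW !mulmxA; congr (_ *m _).
  exact: prod_comm.
have [XA XW] := mem_s (fun A B => A *m X = X *m B) sX.
case=> [i|||] //; rewrite -Lrel -Lrel' -mulmxA XW !mulmxA; congr (_ *m _).
exact: prod_comm.
Qed.

End TurbineRigidity.

(** * Pochhammer local systems *)

Section Pochhammer.
Variable C : fieldType.

Lemma pseudo_reflectionI N (M : 'M[C]_N) lambda :
    lambda != 0 -> lambda != 1 -> (\rank (M - 1%:M)%R <= 1)%N -> \det M = lambda ->
  pseudo_reflection M lambda.
Proof.
move=> lambda0 lambda1 rkM detM; split=> //; first by rewrite unitmxE detM unitfE.
apply/eqP; rewrite codim_fixedE eqn_leq rkM lt0n mxrank_eq0 subr_eq0.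
by apply: contraNneq lambda1 => M1; rewrite -detM M1 det1.
Qed.

Lemma fixed_spaceP N (M : 'M[C]_N) (v : 'rV_N) :
  (v <= fixed_space M)%MS -> M *m v^T = v^T.
Proof.
move=> /sub_kermxP vM; apply/eqP; rewrite -subr_eq0 -{2}[v^T]mul1mx -mulmxBl.
by rewrite -[M - _]trmxK -trmx_mul vM trmx0.
Qed.

Lemma unitmx_fixed_eq0 N p (M : 'M[C]_N) (X : 'M_(N, p)) (a : C) :
  M - a%:M \in unitmx -> M *m X = a *: X -> X = 0.
Proof.
move=> Mu MX; have : (M - a%:M) *m X = 0 by rewrite mulmxBl mul_scalar_mx MX subrr.
by move=> /(congr1 (mulmx (invmx (M - a%:M)))); rewrite mulKmx // mulmx0.
Qed.

Lemma prod_fixed N p (I : Type) (s : seq I) (A : I -> 'M[C]_N) (X : 'M_(N, p)) :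
  (forall i, A i *m X = X) -> (\prod_(i <- s) A i) *m X = X.
Proof.
move=> AX; elim/big_ind: _ => [|B B' BX B'X|//]; first by rewrite mul1mx.
by rewrite -mulmxE -mulmxA B'X.
Qed.

(** A vector fixed by every loop is fixed by their product, the outer boundary. *)
Lemma disc_pochhammerI l (L : rep C 'I_l) :
    rk L = (\sum_i codim_fixed (L i))%N -> disc_outer L - 1%:M \in unitmx ->
  disc_pochhammer L.
Proof.
move=> rkL outer1; split=> //; apply/eqP/rowV0P => v /sub_bigcapmxP vfix.
apply: trmx_inj; rewrite trmx0; apply: (unitmx_fixed_eq0 outer1); rewrite scale1r.
by apply: prod_fixed => i; apply/fixed_spaceP/vfix.
Qed.

Section Turbine.
Variables (k l : nat) (r : int) (L : rep C (turbine_gen l)) (e : C).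
Hypothesis Lsys : turbine_local_system k r L.
Hypothesis L0k : L Omega0 ^+ k = e%:M.

(** The section loops are conjugates of the [alpha_i] by powers of [omega_0]. *)
Lemma codim_section_loop (ji : 'I_k * 'I_l) :
  codim_fixed (section_loop L ji) = codim_fixed (L (Alpha ji.2)).
Proof.
have [Lu _ _ _] := Lsys; rewrite !codim_fixedE /section_loop.
set t := (k - 1 - ji.1)%N; set W := L Omega0.
have Wu : W \in unitmx by apply: Lu.
have Wt : W ^+ t \in unitmx.
  by elim: t => [|t IHt]; rewrite ?expr0 ?unitmx1 // exprS -mulmxE unitmx_mul Wu.
have WVt : invmx W ^+ t = invmx (W ^+ t).
  elim: t {Wt} => [|t IHt]; first by rewrite !expr0 invmx1.
  have Wt : W ^+ t \in unitmx.
    by elim: t {IHt} => [|t IHt]; rewrite ?expr0 ?unitmx1 // exprS -mulmxE unitmx_mul Wu.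
  have WWt : W *m W ^+ t \in unitmx by rewrite unitmx_mul Wu.
  rewrite exprSr IHt exprS -!mulmxE; apply: (can_inj (mulKmx WWt)).
  by rewrite mulmxV // !mulmxA mulmxK // mulmxV.
rewrite WVt; have -> : W ^+ t *m L (Alpha ji.2) *m invmx (W ^+ t) - 1%:M =
    W ^+ t *m (L (Alpha ji.2) - 1%:M) *m invmx (W ^+ t).
  by rewrite mulmxBr mulmxBl mulmx1 mulmxV.
rewrite mxrankMfree ?row_free_unit ?unitmx_inv //.
by rewrite eqmxMfull ?row_full_unit.
Qed.

Lemma turbine_pochhammerE :
  turbine_pochhammer k L -> rk L = (k * \sum_(i < l) codim_fixed (L (Alpha i)))%N.
Proof.
case=> rkL _; rewrite [LHS]rkL; under eq_bigr do rewrite codim_section_loop.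
rewrite -(pair_bigA _ (fun _ i => codim_fixed (L (Alpha i)))) /=.
by rewrite sum_nat_const card_ord.
Qed.

(** If [v] is fixed by all section loops, the [alpha_i] fix W0^(-t) v for t < k, so W W0^(-t-1) v =
    W0^(-t) v. Iterating, u = W0^(-k) v satisfies W^k u = v = W0^k u = e u, which forces u = 0. *)
Lemma turbine_pochhammerI :
    rk L = (k * \sum_(i < l) codim_fixed (L (Alpha i)))%N ->
    L Omega_inf ^+ k - e%:M \in unitmx ->
  turbine_pochhammer k L.
Proof.
move=> rkL Wk; split.
  rewrite [LHS]rkL; under eq_bigr do rewrite codim_section_loop.
  rewrite -(pair_bigA _ (fun _ i => codim_fixed (L (Alpha i)))) /=.
  by rewrite sum_nat_const card_ord.
apply/eqP/rowV0P => v /sub_bigcapmxP vfix; have [Lu Lrel _ _] := Lsys.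
set W0 := L Omega0; set W := L Omega_inf in Wk *.
have W0u : W0 \in unitmx by apply: Lu.
have W0K t p (X : 'M_(_, p)) : W0 ^+ t *m (invmx W0 ^+ t *m X) = X.
  elim: t X => [|t IHt] X; first by rewrite !expr0 !mul1mx.
  by rewrite exprSr exprS -!mulmxE -!mulmxA mulKVmx.
have W0VK t p (X : 'M_(_, p)) : invmx W0 ^+ t *m (W0 ^+ t *m X) = X.
  elim: t X => [|t IHt] X; first by rewrite !expr0 !mul1mx.
  by rewrite exprSr exprS -!mulmxE -!mulmxA mulKmx.
have Afix i t : (t < k)%N -> L (Alpha i) *m (invmx W0 ^+ t *m v^T) = invmx W0 ^+ t *m v^T.
  move=> tk; have jk : (k - 1 - t < k)%N by apply: leq_ltn_trans (leq_subr _ _) _; lia.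
  have := fixed_spaceP (vfix (Ordinal jk, i) isT); rewrite /section_loop /=.
  have -> : (k - 1 - (k - 1 - t) = t)%N by lia.
  rewrite -!mulmxA => vE.
  by rewrite -[LHS](W0VK t) vE.
have WV t : (t <= k)%N -> W ^+ t *m (invmx W0 ^+ t *m v^T) = v^T.
  elim: t => [|t IHt] tk; first by rewrite !expr0 !mul1mx.
  rewrite exprSr exprS -!mulmxE -!mulmxA -[RHS]IHt ?(ltnW tk) //; congr (_ *m _).
  pose A := \prod_(i < l) L (Alpha i).
  have Au : A \in unitmx.
    rewrite /A; elim/big_ind: _ => [|X Y Xu Yu|a _ //]; first exact: unitmx1.
    by rewrite -mulmxE unitmx_mul Xu.
  apply: (can_inj (mulKmx Au)); rewrite (mulmxA A W).
  have -> : A *m W = W0 by exact: Lrel.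
  rewrite mulKVmx //.
  by rewrite /A prod_fixed // => i; apply: Afix.
have Y0 : invmx W0 ^+ k *m v^T = 0.
  apply: (unitmx_fixed_eq0 Wk); rewrite (WV k (leqnn k)).
  by rewrite -{1}(W0K k _ v^T) L0k mul_scalar_mx.
by apply: trmx_inj; rewrite trmx0 -(W0K k _ v^T) Y0 mulmx0.
Qed.

End Turbine.
End Pochhammer.

(** * Uniqueness and existence of Jordan-Pochhammer systems on the disc *)

Section PochhammerOnDisc.
Variables (C : fieldType) (l : nat) (lambda : 'I_l -> C) (eta1 eta2 : C).

Definition disc_rank_data (L : rep C 'I_l) : Prop :=
  [/\ rk L = l,
      forall i, (\rank (L i - 1%:M)%R <= 1)%N /\
        (\rank (L i - (lambda i)%:M)%R + 1 <= rk L)%N,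
      (\rank (disc_outer L - eta1%:M)%R <= 1)%N &
      (\rank (disc_outer L - eta2%:M)%R + 1 <= rk L)%N].

Hypothesis l0 : (0 < l)%N.
Hypothesis eta12 : eta1 != eta2.
Hypothesis lambda1 : forall i, lambda i != 1.

(** The [l] reflections and the outer boundary contribute at most 2 (l - 1) each, in total 2 l^2 - 2
    < 2 l^2. *)
Lemma disc_unique (L L' : rep C 'I_l) :
    disc_local_system L' -> irreducible L ->
    disc_rank_data L -> disc_rank_data L' ->
  rep_iso L L'.
Proof.
case: L => N g; case: L' => N' g' /= Lu' Lirr.
move=> [/= NE LA Lo1 Lo2] [/= NE' LA' Lo1' Lo2']; subst N N'.
rewrite /= in Lo1 Lo2 Lo1' Lo2'.
pose s := [seq (g i, g' i) | i <- index_enum 'I_l].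
have prod1 : \prod_(h <- s) h.1 = disc_outer (Rep g) by rewrite big_map.
have prod2 : \prod_(h <- s) h.2 = disc_outer (Rep g') by rewrite big_map.
have mem_s P : (forall h, h \in s -> P h.1 h.2) -> forall i, P (g i) (g' i).
  move=> sP i; apply: (sP (g i, g' i)).
  by apply/mapP; exists i; rewrite ?mem_index_enum.
apply: irreducible_rep_iso => //.
have lt_rk : (\sum_(h <- s) \rank (intertwine h)
    + \rank (intertwine (\prod_(h <- s) h.1, \prod_(h <- s) h.2)%R) < (l * l).*2)%N.
  rewrite prod1 prod2 big_map.
  have le1 : (\sum_(i < l) \rank (intertwine (g i, g' i)) <= l * l.-1.*2)%N.
    suff le_sum : (\sum_(i < l) \rank (intertwine (g i, g' i)) <= \sum_(i < l) l.-1.*2)%N.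
      by apply: leq_trans le_sum _; rewrite sum_nat_const card_ord.
    apply: leq_sum => i _; have [? ?] := LA i; have [? ?] := LA' i.
    exact: (rank_intertwine_reflection (lambda := lambda i)).
  have le2 : (\rank (intertwine (disc_outer (Rep g), disc_outer (Rep g'))) <= (l.-1 * 1).*2)%N.
    have le1l (x : nat) : (x <= 1 -> x + l.-1 <= l)%N by lia.
    apply: (rank_intertwine_two eta12); rewrite ?addn1 ?prednK //=;
      by [apply: le1l | rewrite -addn1].
  apply: leq_ltn_trans (leq_add le1 le2) _; case: (l) l0 => // l' _ /=; nia.
have gp h : h \in s -> h.2 \in unitmx by move=> /mapP[i _ ->]; apply: Lu'.
case: (katz_intertwiner gp lt_rk) => [[X X0 sX]|[X X0 sX]]; [left | right]; exists X => //.
  exact: (mem_s (fun A B => B *m X = X *m A)).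
exact: (mem_s (fun A B => A *m X = X *m B)).
Qed.

Hypotheses (eta10 : eta1 != 0) (eta11 : eta1 != 1) (eta21 : eta2 != 1).
Hypotheses (lambda0 : forall i, lambda i != 0) (lambda_eta : forall i, lambda i != eta1).
Hypothesis fuchs : \prod_i lambda i = eta1 ^+ l.-1 * eta2.

(* The Jordan-Pochhammer matrices, i.e. the middle convolution by [eta1] of the
   rank one local system with local monodromies [lambda i / eta1]. *)
Let c : 'rV[C]_l := \row_j (lambda j / eta1 - 1).
Let b (i : 'I_l) : 'rV[C]_l :=
  \row_j (if (j < i)%N then eta1 * c 0 j else if j == i then lambda i - 1 else c 0 j).
Let B (i : 'I_l) : 'M[C]_l := 1%:M + delta_mx i (0 : 'I_1) *m b i.
Let scaled (t : nat) : 'M[C]_l := diag_mx (\row_j (if (t <= j)%N then eta1 else 1)).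

(** [scaled t] multiplies by [eta1] the coordinates of index at least [t]. On the kernel of [c], the
    form [b i] composed with [scaled i.+1] reduces to (eta1 - 1) times the coordinate [i], so [B i]
    scales exactly one more coordinate. *)
Let scaled_step (i : 'I_l) p (Q : 'M_(l, p)) :
  c *m Q = 0 -> B i *m (scaled i.+1 *m Q) = scaled i *m Q.
Proof.
move=> cQ; have bs : b i *m scaled i.+1 = eta1 *: c + (eta1 - 1) *: delta_mx 0 i.
  apply/rowP => j; rewrite mul_mx_diag !mxE eqxx /=.
  have [ji|ij|/val_inj->] := ltngtP j i.
  - by rewrite mulr1 -val_eqE /= (ltn_eqF ji) mulr0 addr0.
  - by rewrite -val_eqE /= (gtn_eqF ij) mulr0 addr0 mulrC.
  - rewrite eqxx !mulr1 mulrBr mulr1 mulrCA mulfV // mulr1.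
    by rewrite addrA subrK.
rewrite mulmxDl mul1mx -mulmxA (mulmxA (b i)) bs mulmxDl -!scalemxAl cQ scaler0 add0r.
rewrite -scalemxAr mulmxA mul_delta_mx scalemxAl -mulmxDl; congr (_ *m _).
apply/matrixP => x y; rewrite !mxE.
have [/eqP xi|xi] := boolP (x == i).
  rewrite xi leqnn ltnn /= mulr_natr eq_sym.
  case: (_ == _); last by rewrite addr0.
  by rewrite !mulr1n addrC subrK.
rewrite mulr0 addr0; congr (_ *+ _).
by rewrite [in RHS]leq_eqVlt [(i == x :> nat)]eq_sym val_eqE (negPf xi).
Qed.

Let prod_step n p (A : 'I_n -> 'M[C]_l) (X : nat -> 'M_(l, p)) :
  (forall i : 'I_n, A i *m X i.+1 = X i) -> (\prod_(i < n) A i) *m X n = X 0%N.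
Proof.
elim: n A => [|n IHn] A AX; first by rewrite big_ord0 mul1mx.
rewrite big_ord_recr /= -mulmxE -mulmxA (AX ord_max); apply: IHn => i.
exact: AX (widen_ord _ i).
Qed.

(** Telescoping from [scaled l], the identity, to [scaled 0], the scalar [eta1]: the product of the
    [B i] acts as [eta1] on the kernel of [c], of codimension at most one. *)
Let rank_outer1 : (\rank (\prod_i B i - eta1%:M)%R <= 1)%N.
Proof.
have : (\prod_i B i - eta1%:M) *m cokermx c = 0.
  have cc := mulmx_coker c; rewrite mulmxBl.
  have := prod_step (X := fun t => scaled t *m cokermx c) (fun i => scaled_step i cc).
  have -> : scaled l = 1%:M.
    by apply/matrixP => x y; rewrite !mxE leqNgt ltn_ord.
  have -> : scaled 0 = eta1%:M by apply/matrixP => x y; rewrite !mxE.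
  by rewrite mul1mx => ->; rewrite subrr.
move=> /mulmx0_rank_max; rewrite mxrank_coker; have := rank_leq_row c.
by have := rank_leq_col c; lia.
Qed.

Let det_B i : \det (B i) = lambda i.
Proof.
rewrite /B det_rank1_update mxE (bigD1 i) //= big1 => [|j ji].
  by rewrite !mxE ltnn !eqxx mulr1 addr0 addrC subrK.
by rewrite [X in _ * X]mxE (negPf ji) mulr0.
Qed.

Let det_outer : \det (\prod_i B i) = eta1 ^+ l.-1 * eta2.
Proof.
rewrite -fuchs; transitivity (\prod_i \det (B i)).
  by apply: (big_morph determinant) => [X Y|]; rewrite ?det1 -?mulmxE ?det_mulmx.
by apply: eq_bigr => i _; rewrite det_B.
Qed.

(** For irreducibility, let [S] be stable. If every [b i] vanishes on [S], the outer monodromy fixes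
    [S], so S = 0. Otherwise [S] contains some basis vector e_i; since lambda_i and eta1 differ,
    (B_j - 1) e_i is a nonzero multiple of e_j for every other j, so [S] is everything. *)
Lemma disc_exists : exists L : rep C 'I_l,
  [/\ disc_local_system L, irreducible L, disc_rank_data L,
      forall i, pseudo_reflection (L i) (lambda i) & disc_outer L - 1%:M \in unitmx].
Proof.
(* The last eigenvalue is forced by the determinant, known from the Fuchs relation. *)
have rk2 : (\rank (\prod_i B i - eta2%:M)%R + 1 <= l)%N.
  exact: rank1_eigenvalue rank_outer1 det_outer.
have outer1 : \prod_i B i - 1%:M \in unitmx.
  have c2 : conjugate (\prod_i B i) (scalar_blocks (two eta1 eta2) (two l.-1 1%N)).
    apply: conjugate_two => //; first by rewrite addn1 prednK.
    by rewrite -[leqRHS](prednK l0) -add1n leq_add2r rank_outer1.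
  by apply: conjugate_scalar_blocks_unit c2 _ => i; rewrite /two; case: ifP.
have rkB i : (\rank (B i - 1%:M)%R <= 1)%N.
  by rewrite /B addrC addKr (leq_trans (mxrankM_maxl _ _)) // rank_leq_col.
have reflB i : pseudo_reflection (B i) (lambda i) by apply: pseudo_reflectionI.
exists (Rep B); split=> //=; first by move=> i; case: (reflB i).
- split=> // S stS; have SB i : S *m (B i - 1%:M)^T = S *m (b i)^T *m delta_mx 0 i.
    by rewrite /B addrC addKr trmx_mul trmx_delta mulmxA.
  have sSB i : (S *m (B i - 1%:M)^T <= S)%MS.
    by rewrite raddfB /= trmx1 mulmxBr mulmx1 addmx_sub ?eqmx_opp ?stS.
  have [/forallP Sb|/forallPn[i Sbi]] := boolP [forall i, S *m (b i)^T == 0].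
    left; apply: trmx_inj; rewrite trmx0; apply: (unitmx_fixed_eq0 outer1).
    rewrite scale1r; apply: prod_fixed => i; apply/eqP.
    rewrite -subr_eq0 -{2}[S^T]mul1mx -mulmxBl -[B i - _]trmxK -trmx_mul SB.
    by rewrite (eqP (Sb i)) mul0mx trmx0.
  right; have ei : (delta_mx 0 i : 'rV_l) \in [pred v : 'rV_l | (v <= S)%MS].
    have /rowV0Pn[v /submxP[w vE] v0] := Sbi.
    have v00 : v 0 0 != 0.
      by apply: contraNneq v0 => e; apply/eqP/rowP => j; rewrite ord1 e mxE.
    rewrite inE -[delta_mx 0 i]scale1r -(mulVf v00) -scalerA scalemx_sub //.
    rewrite -mul_scalar_mx -[(v 0 0)%:M]mx11_scalar vE -mulmxA -SB.
    exact: submx_trans (submxMl _ _) (sSB i).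
  rewrite inE in ei; rewrite -sub1mx; apply/row_subP => j; rewrite row1.
  have [->//|ji] := eqVneq j i.
  have bji : b j 0 i != 0.
    rewrite /b mxE [i == j]eq_sym (negPf ji) mxE; have ci : lambda i / eta1 - 1 != 0.
      rewrite subr_eq0; apply: contraNneq (lambda_eta i) => e.
      by rewrite -[lambda i](divfK eta10) e mul1r.
    by case: ifP; rewrite // mulf_neq0.
  have : ((delta_mx 0 i : 'rV_l) *m (B j - 1%:M)^T <= S)%MS.
    exact: submx_trans (submxMr _ ei) (sSB j).
  rewrite /B [1%:M + _]addrC addrK trmx_mul trmx_delta mulmxA -rowE.
  have -> : row i (b j)^T = (b j 0 i)%:M.
    by rewrite [LHS]mx11_scalar; congr (_%:M); rewrite mxE mxE.
  rewrite mul_scalar_mx => sS.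
  by rewrite -[delta_mx 0 j]scale1r -(mulVf bji) -scalerA scalemx_sub.
- split=> //= i; split=> //; have [_] := pseudo_reflection_rank (reflB i).
  by [].
Qed.

End PochhammerOnDisc.

(** * Hypergeometric local systems on the bullet turbine *)

Section NumericalData.
Variables (C : fieldType) (k : nat) (r : int) (l : nat) (eps : C) (zeta : 'I_k -> C).
Hypotheses (zeta_inj : injective zeta).
Hypothesis zeta_root : forall z, z ^+ k = eps ^ r <-> exists j, zeta j = z.
Hypothesis zetaE : 'X^k - (eps ^ r)%:P = \prod_j ('X - (zeta j)%:P).
Variables (lambda : 'I_l -> C) (nu : nat) (x : 'I_nu -> C) (m : 'I_nu -> nat).
Hypotheses (lambda1 : forall i, lambda i != 1) (x_inj : injective x).
Hypotheses (sum_m : (\sum_a m a = k * l)%N) (x_eps : forall a, x a ^+ k != eps ^ r).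
Hypothesis idx : (k * l ^ 2 < l.*2 + \sum_a m a ^ 2)%N.

Lemma rep_iso_conjugate I (L L' : rep C I) g : rep_iso L L' -> conjugate (L g) (L' g).
Proof. by case=> P [Pfree Pfull PL]; exists P. Qed.

Lemma conjugate_scalar N N' (M' : 'M[C]_N') (a : C) :
  conjugate (a%:M : 'M_N) M' -> M' = a%:M.
Proof.
move=> /(conjugate_rank a) /esym; rewrite subrr mxrank0 => /eqP.
by rewrite mxrank_eq0 subr_eq0 => /eqP.
Qed.

Lemma conjugate_rank_data (L L' : rep C (turbine_gen l)) :
    rank_data eps L lambda x m ->
    (forall i, conjugate (L (Alpha i)) (L' (Alpha i))) ->
    conjugate (L Omega_inf) (L' Omega_inf) -> conjugate (L Delta) (L' Delta) ->
  rank_data eps L' lambda x m.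
Proof.
move=> [LD LA LW] cA cW cD; have rkE := conjugate_dim cW; split.
- by apply: (@conjugate_scalar (rk L)); rewrite -LD.
- by move=> i; rewrite -!(conjugate_rank _ (cA i)) -rkE.
- by move=> a; rewrite -(conjugate_rank _ cW) -rkE.
Qed.

Lemma local_data_rank (L : rep C (turbine_gen l)) :
  turbine_local_data k r L eps lambda x m -> rank_data eps L lambda x m /\ rk L = (k * l)%N.
Proof.
move=> [LD LA _ _ LW]; split; last by rewrite (conjugate_dim LW).
split=> // [i|a]; first exact: pseudo_reflection_rank.
exact: conjugate_scalar_blocks_rank.
Qed.

Lemma omega_inf_pow_unit (L : rep C (turbine_gen l)) :
    rank_data eps L lambda x m -> rk L = (k * l)%N ->
  (forall j, L Omega_inf - (zeta j)%:M \in unitmx) /\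
  L Omega_inf ^+ k - (eps ^ r)%:M \in unitmx.
Proof.
move=> [_ _ LW] rkL; have Wu j : L Omega_inf - (zeta j)%:M \in unitmx.
  have cW : conjugate (L Omega_inf) (scalar_blocks x m).
    by apply: conjugate_scalar_blocks; rewrite ?sum_m.
  apply: conjugate_scalar_blocks_unit cW _ => a.
  by apply: contraNneq (x_eps a) => ->; rewrite (root_zeta zetaE).
by split=> //; apply: (omega_inf_unit zetaE).
Qed.

(** The boundary tori determine the classes of [alpha_i], [omega_inf] and [delta], hence
    [rank_data]; rigidity thus reduces to [turbine_unique]. *)
Lemma rank_data_properties (L : rep C (turbine_gen l)) :
    (0 < k)%N ->
    turbine_local_system k r L -> irreducible L -> rk L = (k * l)%N ->
    rank_data eps L lambda x m -> (forall i, pseudo_reflection (L (Alpha i)) (lambda i)) ->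
  [/\ turbine_rigid k r L, turbine_pochhammer1 k L,
      turbine_local_data k r L eps lambda x m &
      forall L', turbine_local_system k r L' -> rank_data eps L' lambda x m ->
        rk L' = (k * l)%N -> rep_iso L L'].
Proof.
move=> k0 Lsys Lirr rkL Ldata Lrefl; have [LD LA LW] := Ldata.
have [Wu Wk] := omega_inf_pow_unit Ldata rkL.
have uniq L' : turbine_local_system k r L' -> rank_data eps L' lambda x m ->
    rk L' = (k * l)%N -> rep_iso L L'.
  move=> Lsys' Ldata' rkL'.
  by apply: (turbine_unique zeta_inj zetaE) Lsys Lsys' _ _ _ Ldata Ldata' _ _ _ _ _; rewrite ?rkL.
have codimA i : codim_fixed (L (Alpha i)) = 1%N by case: (Lrefl i).
split=> //.
- move=> L' Lsys' isoA isoW; apply: uniq => //.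
    apply: conjugate_rank_data Ldata _ _ _ => [i||].
    + exact: (rep_iso_conjugate true (isoA i)).
    + exact: (rep_iso_conjugate true isoW).
    + exact: (rep_iso_conjugate false isoW).
  by rewrite -(conjugate_dim (rep_iso_conjugate true isoW)).
- split; last by move=> ji; rewrite (codim_section_loop Lsys).
  apply: (turbine_pochhammerI Lsys) Wk; first exact: omega0_pow.
  by under eq_bigr do rewrite codimA; rewrite sum1_card card_ord.
- split=> //; last by apply: conjugate_scalar_blocks; rewrite ?sum_m.
  exists zeta; split=> //; apply: conjugate_scalar_blocks => // [|j].
    by rewrite sum_nat_const card_ord.
  by rewrite (omega0_rank zetaE Lsys LD j rkL (fun i => proj1 (LA i)) Wu).
Qed.

End NumericalData.

(** * Companion matrices and hypergeometric groups *)

Section Hypergeometric.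
Variable C : fieldType.

(** Companion matrix whose size is a parameter of its own, so that two polynomials of the same
    degree give matrices of the same type. *)
Definition cmx k (p : {poly C}) : 'M[C]_k :=
  \matrix_(i < k, j < k) if i == k.-1 :> nat then - p`_j else (i.+1 == j :> nat)%:R.

Lemma char_poly_cmx k (p : {poly C}) :
  p \is monic -> size p = k.+1 -> char_poly (cmx k p) = p.
Proof.
move=> p_monic sz_p; have <- : (size p).-1 = k by rewrite sz_p.
exact: companionmxK.
Qed.

Lemma det_cmx k (p : {poly C}) :
  p \is monic -> size p = k.+1 -> \det (cmx k p) = (-1) ^+ k * p`_0.
Proof.
move=> p_monic sz_p; rewrite -[in RHS](char_poly_cmx p_monic sz_p) char_poly_det.
by rewrite mulrA -exprD addnn -muln2 exprM sqrr_sign mul1r.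
Qed.

Lemma rank_cmxB k (p q : {poly C}) : (0 < k)%N -> (\rank (cmx k p - cmx k q)%R <= 1)%N.
Proof.
case: k => // k _.
have -> : cmx k.+1 p - cmx k.+1 q =
    delta_mx ord_max (0 : 'I_1) *m \row_j (q`_j - p`_j).
  apply/matrixP => i j; rewrite !mxE big_ord1 !mxE eqxx andbT /= -val_eqE /=.
  by case: eqP => _; rewrite ?mul1r ?mul0r ?subrr // opprK addrC.
by rewrite (leq_trans (mxrankM_maxl _ _)) // rank_leq_col.
Qed.

Lemma char_poly_XnsubC k (M : 'M[C]_k) e : char_poly M = 'X^k - e%:P -> M ^+ k = e%:M.
Proof.
case: k M => [|k] M; first by move=> _; rewrite [LHS]flatmx0 [RHS]flatmx0.
have := Cayley_Hamilton M => /[swap] ->.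
rewrite rmorphB rmorphXn /= horner_mx_X horner_mx_C => /eqP.
by rewrite subr_eq0 => /eqP.
Qed.

(** Levelt's construction: [omega_0] and [omega_inf] are the companion matrices of X^k - eps^r and
    of the product of the X - x_a. They differ in one row only, so their quotient [A] is a
    pseudo-reflection, and [etaE] gives its determinant. *)
Lemma bullet_exists (k : nat) (r : int) (eps : C) (x : 'I_k -> C) (eta : C) :
    (0 < k)%N -> eps != 0 -> eta != 1 ->
    (forall a, x a != 0) ->
    (forall (W : 'M_k), (forall a, \rank (W - (x a)%:M)%R + 1 <= k)%N ->
       W ^+ k - (eps ^ r)%:M \in unitmx) ->
    eta * \prod_a x a = (-1) ^+ (k - 1) * eps ^ r ->
  exists F : rep C (turbine_gen 1),
    [/\ turbine_local_system k r F, irreducible F, rk F = (k * 1)%N,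
        rank_data eps F (fun _ => eta) x (fun _ => 1%N) &
        forall i, pseudo_reflection (F (Alpha i)) eta].
Proof.
move=> k0 eps0 eta1 x0 Wunit etaE; pose e := eps ^ r.
have e0 : e != 0 by rewrite expfz_neq0.
pose p : {poly C} := 'X^k - e%:P; pose q := \prod_a ('X - (x a)%:P).
have p_monic : p \is monic by apply: monicXnsubC.
have q_monic : q \is monic by apply: monic_prod_XsubC.
have sz_p : size p = k.+1 by rewrite size_XnsubC.
have sz_q : size q = k.+1 by rewrite size_prod_XsubC -sum1_size sum1_card card_ord.
pose W0 := cmx k p; pose W := cmx k q.
have detW0 : \det W0 = (-1) ^+ (k - 1) * e.
  rewrite det_cmx // coefB coefXn coefC /= eq_sym gtn_eqF // sub0r.
  by rewrite -[in LHS](subnKC k0) exprD expr1 mulN1r mulrNN.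
have detW : \det W = \prod_a x a.
  rewrite det_cmx // -horner_coef0 horner_prod.
  under eq_bigr do rewrite !hornerE /= -mulN1r.
  rewrite big_split /= prodr_const card_ord mulrA -exprD addnn -muln2 exprM.
  by rewrite sqrr_sign mul1r.
have prodx0 : \prod_a x a != 0 by apply/prodf_neq0 => a _.
have Wu : W \in unitmx by rewrite unitmxE unitfE detW.
have W0u : W0 \in unitmx by rewrite unitmxE unitfE detW0 mulf_neq0 ?signr_eq0.
pose A := W0 *m invmx W.
have AW : A *m W = W0 by rewrite mulmxKV.
have detA : \det A = eta.
  by rewrite det_mulmx det_inv detW0 detW -etaE mulfK.
have eta0 : eta != 0 by rewrite -detA -unitfE -unitmxE unitmx_mul W0u unitmx_inv.
have rkA : (\rank (A - 1%:M)%R <= 1)%N.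
  have -> : A - 1%:M = (W0 - W) *m invmx W by rewrite mulmxBl mulmxV.
  by rewrite (leq_trans (mxrankM_maxl _ _)) // rank_cmxB.
have reflA : pseudo_reflection A eta by apply: pseudo_reflectionI.
have W0k : W0 ^+ k = e%:M by apply: char_poly_XnsubC; apply: char_poly_cmx.
have rkW a : (\rank (W - (x a)%:M)%R + 1 <= k)%N.
  have : eigenvalue W (x a).
    rewrite eigenvalue_root_char char_poly_cmx // rootE horner_prod.
    by rewrite (bigD1 a) //= !hornerE subrr mul0r.
  move=> /eigenvalueP[v vW v0]; have vW0 : v *m (W - (x a)%:M) = 0.
    by rewrite mulmxBr vW mul_mx_scalar subrr.
  by have := mulmx0_rank_max vW0; rewrite rank_rV v0 addnC.
have Wk := Wunit W rkW.
pose f (g : turbine_gen 1) : 'M[C]_k :=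
  match g with Alpha _ => A | Omega0 => W0 | Omega_inf => W | Delta => eps%:M end.
exists (Rep f); split=> //=.
- split=> /= [[i|||]|||] //.
  + by case: reflA.
  + by rewrite /= unitmxE det_scalar unitfE expf_neq0.
  + by rewrite big_ord1.
  + by move=> g; rewrite scalar_mxC.
  + by rewrite mxpowz_scalar.
- split=> //= S stS; have stW : stablemx S W^T by apply: stS Omega_inf.
  have [SA|SA] := eqVneq (S *m (A - 1%:M)^T) 0.
    by left; apply: (stable_fixed_eq0 AW W0k Wk).
  right; apply: (stable_full AW W0k Wk) => //.
  have sS : (S *m (A - 1%:M)^T <= S)%MS.
    rewrite raddfB /= trmx1 mulmxBr mulmx1 addmx_sub ?eqmx_opp //.
    exact: stS (Alpha 0).
  (* As A - 1 has rank at most one, its nonzero restriction to [S] already has the whole image of A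
     - 1. *)
  apply: submx_trans sS; have := mxrank_leqif_sup (submxMl S (A - 1%:M)^T).
  move=> /geq_leqif <-; rewrite mxrank_tr (leq_trans rkA) //.
  by rewrite lt0n mxrank_eq0.
- by rewrite muln1.
- by split=> //= i; apply: pseudo_reflection_rank.
Qed.

End Hypergeometric.

(** * The extension *)

Section Extension.
Variable C : fieldType.

Lemma mul_mxdiag p (n : 'I_p -> nat) (A B : forall i, 'M[C]_(n i)) :
  \mxdiag_i A i *m \mxdiag_i B i = \mxdiag_i (A i *m B i).
Proof.
rewrite [X in _ *m X]/mxdiag mul_mxdiag_mxblock; apply/eq_mxblockP => i j.
case: eqP => [e|_]; last by rewrite mulmx0.
by case: _ / e; rewrite !conform_mx_id.
Qed.

Lemma diagonalizable_scalar_blocks p (x : 'I_p -> C) (m : 'I_p -> nat) N (M : 'M[C]_N) :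
  conjugate M (scalar_blocks x m) -> diagonalizable M.
Proof.
move=> cM; have e := conjugate_dim cM; subst N.
have /conjugate_square[P Pu PM] := cM; exists P => //.
apply/similar_diagPex; exists (\mxrow_i const_mx (x i)); apply/similarP => //.
rewrite PM diag_mxrow /scalar_blocks; congr (_ *m _); apply: eq_mxdiag => i.
by rewrite diag_const_mx.
Qed.

(** Monodromy of [rep_sum (rep_mul F q) G], in a form convertible to it. *)
Definition dsum q N1 N2 (X : 'M[C]_N1) (Y : 'M[C]_N2) :
    'M[C]_(\sum_(i < q) N1 + N2) :=
  block_mx (@mxdiag C q (fun _ => N1) (fun _ => X)) 0 0 Y.

Lemma dsumM q N1 N2 (X X' : 'M[C]_N1) (Y Y' : 'M[C]_N2) :
  dsum q X Y *m dsum q X' Y' = dsum q (X *m X') (Y *m Y').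
Proof. by rewrite mulmx_block !mul0mx !mulmx0 !addr0 !add0r mul_mxdiag. Qed.

Lemma dsum_scalar q N1 N2 (a : C) :
  dsum q (a%:M : 'M_N1) (a%:M : 'M_N2) = a%:M.
Proof. by rewrite /dsum mxdiagZ -scalar_mx_block. Qed.

Lemma dsumX q N1 N2 (X : 'M[C]_N1) (Y : 'M[C]_N2) n :
  dsum q X Y ^+ n = dsum q (X ^+ n) (Y ^+ n).
Proof.
elim: n => [|n IHn]; first by rewrite !expr0 dsum_scalar.
by rewrite !exprS IHn -!mulmxE dsumM.
Qed.

Lemma rank_dsum q N1 N2 (X : 'M[C]_N1) (Y : 'M[C]_N2) (a : C) :
  \rank (dsum q X Y - a%:M) = (q * \rank (X - a%:M)%R + \rank (Y - a%:M)%R)%N.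
Proof.
rewrite -dsum_scalar /dsum opp_block_mx add_block_mx !oppr0 !addr0 rank_diag_block_mx.
by rewrite -mxdiagB rank_mxdiag sum_nat_const card_ord.
Qed.

Lemma rank_block_mx1 p n (X : 'M[C]_n) (a : C) :
  \rank (block_mx (1%:M : 'M_p) 0 0 X - a%:M) = ((1 != a)%R * p + \rank (X - a%:M)%R)%N.
Proof.
rewrite scalar_mx_block opp_block_mx add_block_mx !oppr0 !addr0 rank_diag_block_mx.
by rewrite -raddfB /= rank_scalar_mx subr_eq0.
Qed.

Lemma unitmx_rank N (X : 'M[C]_N) : (X \in unitmx) = (\rank (X - 0%:M) == N).
Proof. by rewrite raddf0 subr0 -row_free_unit. Qed.

Lemma dsum_unit q N1 N2 (X : 'M[C]_N1) (Y : 'M[C]_N2) :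
  X \in unitmx -> Y \in unitmx -> dsum q X Y \in unitmx.
Proof.
rewrite !unitmx_rank rank_dsum => /eqP-> /eqP->.
by rewrite sum_nat_const card_ord.
Qed.

Variables (k : nat) (r : int) (l : nat) (eps : C) (zeta : 'I_k -> C).
Hypothesis zetaE : 'X^k - (eps ^ r)%:P = \prod_j ('X - (zeta j)%:P).
Hypotheses (k0 : (0 < k)%N) (l0 : (0 < l)%N).
Variables (lambda : 'I_l -> C) (eta1 eta2 : C) (nu : nat) (x : 'I_nu -> C) (m : 'I_nu -> nat).
Hypotheses (lambda0 : forall i, lambda i != 0) (lambda1 : forall i, lambda i != 1).
Hypotheses (eta11 : eta1 != 1) (eta21 : eta2 != 1) (eta12 : eta1 != eta2).
Hypotheses (x_inj : injective x) (sum_m : (\sum_a m a = k * l)%N).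
Hypothesis x_eps : forall a, x a ^+ k != eps ^ r.

Variables (F G : rep C (turbine_gen 1)) (Lt : rep C 'I_l).
Hypotheses (Fsys : turbine_local_system k r F) (Gsys : turbine_local_system k r G).
Hypotheses (rkF : rk F = k) (rkG : rk G = k).
Hypotheses (FD : F Delta = eps%:M) (GD : G Delta = eps%:M).
Hypotheses (FA : pseudo_reflection (F (Alpha 0)) eta1)
           (GA : pseudo_reflection (G (Alpha 0)) eta2).
Hypothesis FGW : forall a,
  ((l - 1) * \rank (F Omega_inf - (x a)%:M)%R + \rank (G Omega_inf - (x a)%:M)%R + m a
     <= k * l)%N.
Hypotheses (Ltsys : disc_local_system Lt) (Ltirr : irreducible Lt).
Hypothesis Ltdata : disc_rank_data lambda eta1 eta2 Lt.
Hypothesis Ltrefl : forall i, pseudo_reflection (Lt i) (lambda i).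
Hypothesis Ltpoch : disc_pochhammer Lt.

Let M := rep_sum (rep_mul F (l - 1)) G.
Let N := rk M.

Let ME g : M g = dsum (l - 1) (F g) (G g). Proof. by []. Qed.

Let NE : N = (k * l)%N.
Proof.
rewrite /N /M /= sum_nat_const card_ord rkF rkG.
by rewrite -mulSnr -addn1 subnK // mulnC.
Qed.

Let lN : (l <= N)%N. Proof. by rewrite NE leq_pmull. Qed.

Let MD : M Delta = eps%:M. Proof. by rewrite ME FD GD dsum_scalar. Qed.

Let Msys : turbine_local_system k r M.
Proof.
have [Fu Frel Fc F0] := Fsys; have [Gu Grel Gc G0] := Gsys.
rewrite !big_ord1 in Frel Grel; split.
- by move=> g; rewrite ME dsum_unit.
- by rewrite big_ord1 !ME dsumM Frel Grel.
- by move=> g; rewrite MD scalar_mxC.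
- by rewrite MD mxpowz_scalar ME dsumX F0 G0 FD GD !mxpowz_scalar dsum_scalar.
Qed.

Let rank_MA a : \rank (M (Alpha 0) - a%:M) =
  ((l - 1) * \rank (F (Alpha 0) - a%:M)%R + \rank (G (Alpha 0) - a%:M)%R)%N.
Proof. exact: rank_dsum. Qed.

Let codim_MA : codim_fixed (M (Alpha 0)) = l.
Proof.
rewrite codim_fixedE rank_MA -!codim_fixedE.
by case: FA => _ -> _ _; case: GA => _ -> _ _; rewrite muln1 subnK.
Qed.

(* The monodromy of [M] around the merged knot fixes a subspace of codimension
   [l], on a complement of which it is the monodromy of [Lt] at infinity. *)
Let conjugate_outer :
  conjugate (M (Alpha 0)) (block_mx (1%:M : 'M[C]_(N - l)) 0 0 (disc_outer Lt)).
Proof.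
(* Both matrices are diagonalizable with eigenvalues 1, [eta1], [eta2] of multiplicities N - l, l -
   1, 1. *)
pose y := tnth [tuple 1; eta1; eta2]; pose p := tnth [tuple (N - l)%N; (l - 1)%N; 1%N].
have [rkLt _ Lto1 Lto2] := Ltdata.
have y_inj : injective y.
  apply/tuple_uniqP; rewrite /= !inE !negb_or andbT.
  by rewrite eq_sym eta11 eq_sym eta21 eta12.
have sum_p : (\sum_i p i = N)%N.
  by rewrite !big_ord_recl big_ord0 /p /tnth /= addn0 subnK // subnK.
have conj3 n (B : 'M[C]_n) : n = N -> (\rank (B - 1%:M)%R <= l)%N ->
    (\rank (B - eta1%:M)%R + (l - 1) <= n)%N -> (\rank (B - eta2%:M)%R + 1 <= n)%N ->
    conjugate B (scalar_blocks y p).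
  move=> nN B1 B2 B3; apply: conjugate_scalar_blocks => //; first by rewrite sum_p.
  move=> [[|[|[|i]]] hi] //; rewrite /y /p /tnth //=.
  by apply: leq_trans (leq_add B1 (leqnn _)) _; rewrite nN subnKC.
have kl : N = ((l - 1) * k + k)%N by rewrite NE -mulSnr -addn1 subnK // mulnC.
rewrite -/N in kl *; apply: conjugate_trans (conjugate_sym _); apply: conj3.
- by [].
- by rewrite -codim_fixedE codim_MA.
- rewrite rank_MA; have [_] := pseudo_reflection_rank FA.
  have := rank_leq_row (G (Alpha 0) - eta1%:M).
  move: (\rank (F _ - _)) (\rank (G _ - _)) => f g; rewrite rkF rkG kl => leg leF.
  rewrite addnAC -[X in (_ + X + _)%N]muln1 -mulnDr leq_add // leq_mul2l.
  by rewrite leF orbT.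
- rewrite rank_MA; have [_] := pseudo_reflection_rank GA.
  have := rank_leq_row (F (Alpha 0) - eta2%:M).
  move: (\rank (F _ - _)) (\rank (G _ - _)) => f g; rewrite rkF rkG kl => lef leG.
  by rewrite -addnA leq_add // leq_mul2l lef orbT.
- by rewrite rkLt subnK.
- rewrite rank_block_mx1 eqxx mul0n add0n.
  by rewrite -[leqRHS]rkLt rank_leq_row.
- rewrite rank_block_mx1 eq_sym eta11 mul1n -addnA leq_add2l.
  by apply: leq_trans (leq_add Lto1 (leqnn (l - 1))) _; rewrite subnKC // rkLt.
- by rewrite rank_block_mx1 eq_sym eta21 mul1n -addnA leq_add2l.
Qed.

(** The Pochhammer dimension formula makes the codimensions of the fixed spaces of the [alpha_i] add
    up to [l]. Each is at least 1, as [alpha_i] induces a pseudo-reflection on the quotient, so each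
    is 1. The eigenvalue [lambda i] is inherited from the quotient, and [delta] and [omega_inf] come
    from the restriction isomorphic to [M]. *)
Lemma extension_unique (L : rep C (turbine_gen l)) :
    turbine_local_system k r L -> extension_via k L M Lt ->
  rank_data eps L lambda x m /\ rk L = (k * l)%N.
Proof.
move=> Lsys [Lpoch _ _ isoM [K sK [q [q_free qK qA]]]].
have rkL : rk L = (k * l)%N.
  by rewrite -NE; apply: conjugate_dim (rep_iso_conjugate Delta isoM).
have [rkLt LtA _ _] := Ltdata.
have codim_ge i : (1 <= \rank (L (Alpha i) - 1%:M)%R)%N.
  rewrite lt0n mxrank_eq0; have [_ codim1 _ _] := Ltrefl i.
  apply: contra_eqN codim1 => /eqP LA1; rewrite codim_fixedE eqn_leq.
  have : (Lt i - 1%:M) *m q = 0.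
    by rewrite mulmxBl mul1mx -qA -{2}[q]mulmx1 -mulmxBr LA1 mulmx0.
  by move=> /(congr1 mxrank); rewrite mxrankMfree // mxrank0 => ->.
have sum_rk : (\sum_(i < l) \rank (L (Alpha i) - 1%:M)%R = l)%N.
  have /eqP : (k * l = k * \sum_(i < l) codim_fixed (L (Alpha i)))%N.
    by rewrite -[LHS]rkL; apply: turbine_pochhammerE Lsys Lpoch.
  rewrite eqn_pmul2l // => /eqP lE; symmetry; rewrite [LHS]lE.
  by apply: eq_bigr => i _; rewrite codim_fixedE.
have rk1 i : (\rank (L (Alpha i) - 1%:M)%R <= 1)%N.
  move: sum_rk; rewrite (bigD1 i) //= => sum_rk; rewrite leqNgt; apply/negP => gt1.
  have : (\sum_(j < l | j != i) 1 <= \sum_(j < l | j != i) \rank (L (Alpha j) - 1%:M)%R)%N.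
    by apply: leq_sum.
  rewrite sum1_card cardC1 card_ord => le_s; have := leq_add gt1 le_s.
  by rewrite sum_rk; case: (l) l0 => // l' _; rewrite /= addSn add1n ltnn.
split=> //; split.
- apply: (@conjugate_scalar _ N); rewrite -MD.
  exact: conjugate_sym (rep_iso_conjugate Delta isoM).
- move=> i; split=> //; have [_ rk_lam] := LtA i.
  have : ~~ row_free (Lt i - (lambda i)%:M).
    by rewrite /row_free neq_ltn -addn1 rk_lam.
  rewrite -kermx_eq0 => /rowV0Pn[v /sub_kermxP vL v0].
  (* A left eigenvector of [Lt i] pulls back along [q] to one of [alpha_i]. *)
  have vq : v *m q *m (L (Alpha i) - (lambda i)%:M) = 0.
    by rewrite -mulmxA mulmxBr qA scalar_mxC -mulmxBl mulmxA vL mul0mx.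
  have := mulmx0_rank_max vq; rewrite mxrankMfree // rank_rV v0 addnC.
  exact.
- move=> a; rewrite (conjugate_rank _ (rep_iso_conjugate Omega_inf isoM)) rkL.
  by rewrite ME rank_dsum.
Qed.

Lemma extension_exists : exists L : rep C (turbine_gen l),
  [/\ turbine_local_system k r L, irreducible L, rk L = (k * l)%N,
      rank_data eps L lambda x m /\ (forall i, pseudo_reflection (L (Alpha i)) (lambda i)) &
      turbine_pochhammer k L -> extension_via k L M Lt].
Proof.
have [P [P_free P_full PM]] := conjugate_outer.
rewrite -/N in P P_free P_full PM *.
have [rkLt LtA _ _] := Ltdata.
(* [P] is a two-sided isomorphism between spaces whose dimensions are equal but not convertible, so
   its inverse is a pseudo-inverse. *)
have [P' PV VP] : exists2 P', P *m P' = 1%:M & P' *m P = 1%:M.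
  by exists (pinvmx P); [apply: mulmxVp | apply: mulVpmx].
pose blk (X : 'M[C]_(rk Lt)) : 'M[C]_(N - l + rk Lt) := block_mx 1%:M 0 0 X.
have blkM X Y : blk X *m blk Y = blk (X *m Y).
  by rewrite mulmx_block !mul0mx !mulmx0 mul1mx !addr0 add0r.
pose lift X : 'M[C]_N := P' *m blk X *m P.
have liftM X Y : lift X *m lift Y = lift (X *m Y).
  by rewrite /lift !mulmxA -(mulmxA _ P) PV mulmx1 -(mulmxA _ (blk X)) blkM.
have lift_conj X : conjugate (lift X) (blk X).
  by exists P; split=> //; rewrite /lift !mulmxA PV mul1mx.
have lift_outer : lift (disc_outer Lt) = M (Alpha 0).
  by rewrite /lift -mulmxA -PM mulmxA VP mul1mx.
have lift1 : lift 1%:M = 1%:M by rewrite /lift /blk -scalar_mx_block mulmx1 VP.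
have lift_prod : \prod_(i < l) lift (Lt i) = lift (disc_outer Lt).
  rewrite /disc_outer; elim/big_ind2: _ => [|X X' Y Y' -> ->|//]; rewrite ?lift1 //.
  by rewrite -!mulmxE liftM.
(* The lower rows of [P] project the fibre onto that of [Lt]; the kernel of [q] is the constant
   subsheaf, since every [lift X - 1%:M] factors through [q]. *)
pose q := dsubmx P; have q_lift X : q *m lift X = X *m q.
  rewrite /q mul_dsub_mx /lift !mulmxA PV mul1mx -{1}[P]vsubmxK mul_block_col col_mxKd.
  by rewrite mul0mx add0r.
have q_free : row_free q.
  apply/row_freeP; exists (P' *m col_mx 0 1%:M).
  by rewrite mulmxA /q mul_dsub_mx PV mul_dsub_mx mul1mx col_mxKd.
have lift_sub1 X : lift X - 1%:M = P' *m col_mx 0 (X - 1%:M) *m q.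
  rewrite /lift -VP -mulmxA -mulmxBr -mulmxA; congr (_ *m _).
  rewrite [RHS]mul_col_mx mul0mx mulmxBl mul1mx -{1 2}[P]vsubmxK mul_block_col.
  by rewrite mul1mx !mul0mx addr0 add0r opp_col_mx add_col_mx subrr.
pose f (g : turbine_gen l) : 'M[C]_N :=
  match g with
  | Alpha i => lift (Lt i) | Omega0 => M Omega0 | Omega_inf => M Omega_inf | Delta => M Delta
  end.
have f_comm g : f g *m f Delta = f Delta *m f g.
  by have -> : f Delta = eps%:M := MD; rewrite scalar_mxC.
have lift_unit X : X \in unitmx -> lift X \in unitmx.
  by rewrite !unitmxE (conjugate_det (lift_conj X)) /blk det_ublock det1 mul1r.
have [Mu Mrel Mc M0] := Msys; rewrite big_ord1 in Mrel.
have Lsys : turbine_local_system k r (Rep f).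
  split=> /=.
  - by case=> [i|||] /=; [apply: lift_unit | apply: Mu | apply: Mu | apply: Mu].
  - by rewrite lift_prod lift_outer.
  - exact: f_comm.
  - exact: M0.
have Lrefl i : pseudo_reflection (Rep f (Alpha i)) (lambda i).
  apply: pseudo_reflectionI => //=.
    rewrite (conjugate_rank _ (lift_conj _)) rank_block_mx1 eqxx.
    by case: (LtA i).
  rewrite (conjugate_det (lift_conj _)) /blk det_ublock det1 mul1r.
  by case: (Ltrefl i).
have Ldata : rank_data eps (Rep f) lambda x m.
  split=> [|i|a]; [exact: MD | exact: pseudo_reflection_rank (Lrefl i) |].
  have : (\rank (M Omega_inf - (x a)%:M)%R + m a <= N)%N by rewrite ME rank_dsum NE.
  exact.
have [Wu Wk] := omega_inf_pow_unit zetaE x_inj sum_m x_eps Ldata NE.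
have M0k : M Omega0 ^+ k = (eps ^ r)%:M by rewrite M0 MD mxpowz_scalar.
rewrite /= in Wk; exists (Rep f); split=> //.
- split=> [|S stS]; first by rewrite /= -/N NE muln_gt0 k0.
  have stW : stablemx S (M Omega_inf)^T by apply: stS Omega_inf.
  have stA i : stablemx S (lift (Lt i))^T by apply: stS (Alpha i).
  have stT i : stablemx <<S *m q^T>>%MS (Lt i)^T.
    rewrite (eqmxMr _ (genmxE _)) genmxE -mulmxA -trmx_mul -q_lift trmx_mul mulmxA.
    exact: submxMr (stA i).
  have subS i : (S *m (lift (Lt i) - 1%:M)^T <= S)%MS.
    by rewrite raddfB /= trmx1 mulmxBr mulmx1 addmx_sub ?eqmx_opp.
  (* The image of [S] under [q] is zero or full. If zero, [alpha_bullet] is trivial on [S]. If full,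
     [S] contains the image of every alpha_i - 1, hence that of alpha_bullet - 1. *)
  have [_ /(_ _ stT)[T0|T1]] := Ltirr; [left | right].
    apply: (stable_fixed_eq0 Mrel M0k Wk stW).
    have /eqP := T0; rewrite -submx0 genmxE submx0 => /eqP Sq.
    by rewrite -lift_outer lift_sub1 trmx_mul mulmxA Sq mul0mx.
  have Sq : (1%:M <= S *m q^T)%MS by have := T1; rewrite -sub1mx genmxE.
  apply: (stable_full Mrel M0k Wk stW).
  rewrite -lift_outer -lift_prod; elim/big_ind: _ => [|A B SA SB|i _].
  - by rewrite subrr trmx0 sub0mx.
  - have -> : A * B - 1%:M = (A - 1%:M) *m B + (B - 1%:M).
      by rewrite mulmxBl mul1mx addrA subrK.
    rewrite raddfD /= trmx_mul addmx_sub // (submx_trans _ SA) //.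
    exact: submxMl.
  - apply: submx_trans (subS i); rewrite lift_sub1 trmx_mul mulmxA submxMr //.
    exact: submx_trans (submx1 _) Sq.
- move=> Lpoch; split=> //.
  + apply: (turbine_pochhammerI Msys M0k) => //.
    by rewrite big_ord1 codim_MA; apply: NE.
  + exists 1%:M; rewrite ?row_free_unit ?row_full_unit ?unitmx1; split=> //.
    case=> [i|||] /=; rewrite ?mul1mx ?mulmx1 //.
    by rewrite lift_prod lift_outer ord1.
  + exists (kermx q^T); last by exists q; split=> // i; apply: q_lift.
    by move=> i; rewrite sub_kermx lift_sub1 trmx_mul mulmxA mulmx_ker mul0mx.
Qed.

End Extension.

(** * Numerical local data and rigidity on the disc *)

Section DiscData.
Variables (C : fieldType) (l : nat) (lambda : 'I_l -> C) (eta1 eta2 : C).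
Hypotheses (l0 : (0 < l)%N) (eta12 : eta1 != eta2).

Let D := block_mx (eta1%:M : 'M[C]_(l.-1)) 0 0 (eta2%:M : 'M[C]_1).

Let rank_D a : (\rank (D - a%:M)%R = (eta1 != a)%R * l.-1 + (eta2 != a)%R)%N.
Proof.
rewrite /D scalar_mx_block opp_block_mx add_block_mx !oppr0 !addr0 rank_diag_block_mx.
by rewrite -!raddfB /= !rank_scalar_mx !subr_eq0 muln1.
Qed.

Lemma disc_local_data_rank (L : rep C 'I_l) :
  disc_local_data L lambda eta1 eta2 -> disc_rank_data lambda eta1 eta2 L.
Proof.
move=> [rkL Lrefl cD]; split=> // [i||].
- exact: pseudo_reflection_rank.
- by rewrite (conjugate_rank _ cD) rank_D eqxx mul0n add0n leq_b1.
- rewrite (conjugate_rank _ cD) rank_D eqxx addn0 eta12 mul1n rkL.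
  by rewrite addn1 prednK.
Qed.

Lemma disc_rank_local_data (L : rep C 'I_l) :
    disc_rank_data lambda eta1 eta2 L -> (forall i, pseudo_reflection (L i) (lambda i)) ->
  disc_local_data L lambda eta1 eta2.
Proof.
move=> [rkL LA Lo1 Lo2] Lrefl; split=> //; rewrite -/D.
have l1 : (l.-1 + 1 = l)%N by rewrite addn1 prednK.
apply: conjugate_trans (conjugate_sym _); apply: (conjugate_two (p := l.-1) (q := 1%N) eta12).
- by rewrite l1 rkL.
- by apply: leq_trans (leq_add Lo1 (leqnn _)) _; rewrite addnC l1 rkL.
- exact: Lo2.
- by [].
- by rewrite rank_D eqxx mul0n add0n addnC leq_add2l leq_b1.
- by rewrite rank_D eqxx addn0 eta12 mul1n.
Qed.

Hypothesis lambda1 : forall i, lambda i != 1.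

Lemma disc_rank_data_properties (L : rep C 'I_l) :
    irreducible L -> disc_rank_data lambda eta1 eta2 L ->
    (forall i, pseudo_reflection (L i) (lambda i)) ->
    disc_outer L - 1%:M \in unitmx ->
  [/\ disc_rigid L, disc_pochhammer1 L, disc_local_data L lambda eta1 eta2 &
      forall L', disc_local_system L' -> disc_local_data L' lambda eta1 eta2 -> rep_iso L L'].
Proof.
move=> Lirr Ldata Lrefl L1; have [rkL LA Lo1 Lo2] := Ldata.
have codimA i : codim_fixed (L i) = 1%N by case: (Lrefl i).
split.
- move=> L' Lsys' cA co; apply: (disc_unique l0 eta12 lambda1) Ldata _ => //.
  have rkE := conjugate_dim co; split; first by rewrite -rkE.
  + by move=> i; rewrite -!(conjugate_rank _ (cA i)) -rkE.
  + by rewrite -(conjugate_rank _ co).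
  + by rewrite -(conjugate_rank _ co) -rkE.
- split=> //; apply: disc_pochhammerI => //.
  by under eq_bigr do rewrite codimA; rewrite sum1_card card_ord.
- exact: disc_rank_local_data.
- move=> L' Lsys' /disc_local_data_rank; exact: (disc_unique l0 eta12 lambda1).
Qed.

End DiscData.

(** * Index computations: omitting one of the last two parameters *)

Section SplitLast.
Variables (T : Type) (idx : T) (op : Monoid.com_law idx) (k : nat) (f : 'I_k.+1 -> T).
Hypothesis k0 : (0 < k)%N.

Lemma big_lt_pred :
  \big[op/idx]_(i < k.+1 | (i < k)%N) f i =
    op (\big[op/idx]_(i < k.+1 | (i < k - 1)%N) f i) (f (inord (k - 1))).
Proof.
rewrite (bigD1 (inord (k - 1))) /=; last by rewrite inordK; lia.
rewrite Monoid.mulmC; congr (op _ _); apply: eq_bigl => i.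
by rewrite -val_eqE /= inordK; lia.
Qed.

Lemma big_lift_max :
  \big[op/idx]_(i < k) f (lift ord_max i) =
    op (\big[op/idx]_(i < k.+1 | (i < k - 1)%N) f i) (f (inord (k - 1))).
Proof.
rewrite -big_lt_pred [RHS]big_mkcond big_ord_recr /= ltnn Monoid.mulm1.
apply: eq_bigr => i _; rewrite ltn_ord; congr f; apply: val_inj.
by rewrite /= /bump; have := ltn_ord i; lia.
Qed.

Lemma big_lift_pred :
  \big[op/idx]_(i < k) f (lift (inord (k - 1)) i) =
    op (\big[op/idx]_(i < k.+1 | (i < k - 1)%N) f i) (f ord_max).
Proof.
have jk : (inord (k - 1) : 'I_k.+1) != ord_max.
  by rewrite -val_eqE /= inordK; lia.
rewrite [X in op X _](eq_bigl (fun i => (i != inord (k - 1)) && (i != ord_max))); last first.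
  by move=> i; rewrite -!val_eqE /= inordK; have := ltn_ord i; lia.
rewrite Monoid.mulmC -(bigD1 ord_max) ?(eq_sym _ (inord _)) //=.
rewrite (reindex (lift (inord (k - 1)))) /=.
  by apply: eq_bigl => i; rewrite eq_sym neq_lift.
(* The default [Ordinal k0] is never reached on the indices under consideration. *)
exists (fun i => odflt (Ordinal k0) (unlift (inord (k - 1)) i)) => i.
  by rewrite liftK.
by rewrite inE eq_sym => /unlift_some[j -> ->].
Qed.

End SplitLast.

(** Here [p] is the product of the first k - 1 of the xi, while [u] and [v] are the last two.
    Writing se^l as (eta1 p u)^(l-1) (eta2 p v) and cancelling leaves the determinant condition for
    [Lt]. *)
Lemma fuchs_relation (C : fieldType) l (Lambda se p u v eta1 eta2 : C) :
    (0 < l)%N -> p * u * v != 0 -> eta1 * (p * u) = se -> eta2 * (p * v) = se ->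
    Lambda * (p ^+ l * u ^+ l.-1 * v) = se ^+ l ->
  Lambda = eta1 ^+ l.-1 * eta2.
Proof.
move=> l0; rewrite !mulf_eq0 !negb_or => /andP[/andP[p0 u0] v0] e1 e2 LE.
have D0 : p ^+ l * u ^+ l.-1 * v != 0 by rewrite !mulf_neq0 // expf_neq0.
apply: (mulIf D0); rewrite LE -(prednK l0) /= !exprS -{1}e2 -e1 !exprMn.
by move: (eta1 ^+ _) (p ^+ _) (u ^+ _) => x1 x2 x3; ring.
Qed.

Lemma sum_multiplicities k l (g : nat -> nat) : (0 < k)%N ->
  (\sum_(i < k.+1) g (if (i < k - 1)%N then l
      else if i == (k - 1)%N :> nat then (l - 1)%N else 1%N) =
    (k - 1) * g l + g (l - 1) + g 1)%N.
Proof.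
case: k => // k _; rewrite subn1 /= !big_ord_recr /= ltnn eqxx.
rewrite ltnNge leqnSn (gtn_eqF (ltnSn k)) /=; congr (_ + _ + _)%N.
rewrite (eq_bigr (fun _ => g l)) => [|i _]; last by rewrite ltn_ord.
by rewrite sum_nat_const card_ord.
Qed.

(** Eigenvalue count for [omega_inf] on F^(l-1) + G, with 0-based position [t]: [F] misses the value
    at k and [G] the one at k - 1. *)
Lemma multiplicity_bound k l t f g : (0 < k)%N -> (0 < l)%N -> (t < k.+1)%N ->
    (f + (t != k) <= k)%N -> (g + (t != k - 1)%N <= k)%N ->
  ((l - 1) * f + g + (if (t < k - 1)%N then l else if t == (k - 1)%N then (l - 1)%N else 1%N)
     <= k * l)%N.
Proof.
move=> k0 l0 t_lt; case: (ltngtP t (k - 1)%N) => tk; case: eqP => tk'; rewrite /=; nia.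
Qed.

Theorem theorem6p5 (R : realType) (n k l : nat) (r s : int)
    (epsilon : R[i]) (lambda : 'I_l -> R[i]) (xi : 'I_k.+1 -> R[i])
    (hk : (1 <= k)%N) (hnk : (k < n)%N) (hcop : coprime n k) (hl : (1 <= l)%N)
    (hrs : r * n%:Z = k%:Z * s + 1)
    (heps0 : epsilon != 0)
    (hlambda0 : forall i, lambda i != 0)
    (hxi0 : forall i, xi i != 0)
    (* 0-based: xi_k and xi_{k+1} are the last two entries of xi *)
    (xi_k := xi (inord (k - 1))) (xi_k1 := xi ord_max)
    (eta1 := (-1) ^+ (k - 1) * epsilon ^ r
               * \prod_(i < k.+1 | (i < k)%N) (xi i)^-1)
    (eta2 := (-1) ^+ (k - 1) * epsilon ^ r * xi_k1^-1
               * \prod_(i < k.+1 | (i < k - 1)%N) (xi i)^-1)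
    (hlambda1 : forall i, lambda i != 1) (heta1 : eta1 != 1) (heta2 : eta2 != 1)
    (hlambda_eta : forall i, lambda i != eta1)
    (hxi_inj : forall i j, i != j -> xi i != xi j)
    (hsum1 : \sum_(i < k.+1 | (i < k)%N) xi i != 0)
    (hsum2 : \sum_(i < k.+1 | (i < k - 1)%N) xi i + xi_k1 != 0)
    (hxi_eps : forall i, xi i ^+ k != epsilon ^ r)
    (hFuchs : (\prod_(i < l) lambda i)
                * (\prod_(i < k.+1 | (i < k - 1)%N) xi i ^+ l)
                * xi_k ^+ (l - 1) * xi_k1
              = (-1) ^+ ((k - 1) * l) * epsilon ^ (r * l%:Z))
    (* (xi_1, ..., xi_k) and (xi_1, ..., xi_{k-1}, xi_{k+1}) *)
    (xiF := fun i : 'I_k => xi (lift ord_max i))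
    (xiG := fun i : 'I_k => xi (lift (inord (k - 1)) i))
    (* (l, ..., l, l-1, 1) *)
    (m := fun i : 'I_k.+1 =>
            if (i < k - 1)%N then l
            else if i == (k - 1)%N :> nat then (l - 1)%N else 1%N) :
  exists (F G : rep R[i] (turbine_gen 1)) (Lt : rep R[i] 'I_l),
  [/\ (* (i) *)
      [/\ turbine_local_system k r F,
          irreducible F, turbine_rigid k r F, turbine_pochhammer1 k F &
          turbine_local_data k r F epsilon (fun _ => eta1) xiF (fun _ => 1%N) /\
          forall F', turbine_local_system k r F' ->
            turbine_local_data k r F' epsilon (fun _ => eta1) xiF (fun _ => 1%N) ->
            rep_iso F F']
      /\
      [/\ turbine_local_system k r G,
          irreducible G, turbine_rigid k r G, turbine_pochhammer1 k G &
          turbine_local_data k r G epsilon (fun _ => eta2) xiG (fun _ => 1%N) /\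
          forall G', turbine_local_system k r G' ->
            turbine_local_data k r G' epsilon (fun _ => eta2) xiG (fun _ => 1%N) ->
            rep_iso G G'],
      (* (ii) *)
      [/\ disc_local_system Lt, disc_rigid Lt, disc_pochhammer1 Lt &
          disc_local_data Lt lambda eta1 eta2 /\
          forall Lt', disc_local_system Lt' ->
            disc_local_data Lt' lambda eta1 eta2 -> rep_iso Lt Lt'] &
      (* (iii) *)
      exists L : rep R[i] (turbine_gen l),
        [/\ turbine_local_system k r L /\
            turbine_local_data k r L epsilon lambda xi m,
            irreducible L, turbine_rigid k r L,
            turbine_pochhammer1 k L /\ diagonalizable (L Omega_inf) &
            extension_via k L (rep_sum (rep_mul F (l - 1)) G) Lt /\
            forall L', turbine_local_system k r L' ->
              extension_via k L' (rep_sum (rep_mul F (l - 1)) G) Lt ->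
              rep_iso L L']].
Proof.
pose C : closedFieldType := R[i].
have kC0 : k%:R != 0 :> C by rewrite Num.Theory.pnatr_eq0 -lt0n.
have e0 : epsilon ^ r != 0 by rewrite expfz_neq0.
have [zeta [zeta_inj zeta_root zetaE]] := exists_roots hk kC0 e0.
have xi_inj : injective xi.
  by move=> i j /eqP xij; apply/eqP; apply: contraLR xij => /hxi_inj.
have xiF_inj : injective xiF by move=> i j /xi_inj /lift_inj.
have xiG_inj : injective xiG by move=> i j /xi_inj /lift_inj.
have sum1k : (\sum_(a < k) 1 = k * 1)%N by rewrite sum1_card card_ord muln1.
have idx1 : (k * 1 ^ 2 < 1.*2 + \sum_(a < k) 1 ^ 2)%N.
  by rewrite sum1_card card_ord muln1 add2n ltnS leqnSn.
have Wunit (x : 'I_k -> C) : injective x -> (forall a, x a ^+ k != epsilon ^ r) ->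
    forall W : 'M_k, (forall a, \rank (W - (x a)%:M)%R + 1 <= k)%N ->
      W ^+ k - (epsilon ^ r)%:M \in unitmx.
  move=> x_inj x_eps W rkW; apply: (omega_inf_unit zetaE) => j.
  have cW : conjugate W (scalar_blocks x (fun _ => 1%N)).
    by apply: conjugate_scalar_blocks; rewrite ?sum1k ?muln1.
  apply: conjugate_scalar_blocks_unit cW _ => a.
  by apply: contraNneq (x_eps a) => ->; rewrite (root_zeta zetaE).
pose P0 := \prod_(i < k.+1 | (i < k - 1)%N) xi i.
have P00 : P0 != 0 by apply/prodf_neq0 => i _; apply: hxi0.
have xik0 : xi_k != 0 by apply: hxi0.
have xik10 : xi_k1 != 0 by apply: hxi0.
pose se := (-1) ^+ (k - 1) * epsilon ^ r.
have se0 : se != 0 by rewrite mulf_neq0 // signr_eq0.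
have eta1E : eta1 = se / (P0 * xi_k).
  by rewrite /eta1 prodfV (big_lt_pred _ _ hk).
have eta2E : eta2 = se / (P0 * xi_k1).
  by rewrite /eta2 prodfV -/P0 -mulrA invfM [_^-1 * P0^-1]mulrC.
have etaF : eta1 * \prod_a xiF a = se.
  by rewrite (big_lift_max _ _ hk) eta1E divfK // mulf_neq0.
have etaG : eta2 * \prod_a xiG a = se.
  by rewrite (big_lift_pred _ _ hk) eta2E divfK // mulf_neq0.
have eta10 : eta1 != 0 by rewrite eta1E mulf_neq0 // invr_eq0 mulf_neq0.
(* They differ only in the factor xi_k against xi_{k+1}. *)
have eta12 : eta1 != eta2.
  rewrite eta1E eta2E; apply/eqP => /(mulfI se0) /invr_inj /(mulfI P00) /xi_inj.
  by move/(congr1 val); rewrite /= inordK => [|]; clear -hk; lia.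
have fuchs : \prod_i lambda i = eta1 ^+ l.-1 * eta2.
  have fuchsE : \prod_i lambda i * (P0 ^+ l * xi_k ^+ l.-1 * xi_k1) = se ^+ l.
    move: hFuchs; rewrite prodrXl -/P0 subn1 !mulrA => ->.
    by rewrite exprMn exprM -exprz_exp.
  apply: (fuchs_relation hl _ _ _ fuchsE); rewrite ?mulf_neq0 //.
    by rewrite eta1E divfK // mulf_neq0.
  by rewrite eta2E divfK // mulf_neq0.
have [F [Fsys Firr rkF Fdata Frefl]] :
    exists F : rep C (turbine_gen 1), [/\ turbine_local_system k r F, irreducible F,
      rk F = (k * 1)%N, rank_data epsilon F (fun _ => eta1) xiF (fun _ => 1%N) &
      forall i, pseudo_reflection (F (Alpha i)) eta1].
  by apply: bullet_exists => // [a|]; [apply: hxi0 | apply: Wunit => // a; apply: hxi_eps].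
have [G [Gsys Girr rkG Gdata Grefl]] :
    exists G : rep C (turbine_gen 1), [/\ turbine_local_system k r G, irreducible G,
      rk G = (k * 1)%N, rank_data epsilon G (fun _ => eta2) xiG (fun _ => 1%N) &
      forall i, pseudo_reflection (G (Alpha i)) eta2].
  by apply: bullet_exists => // [a|]; [apply: hxi0 | apply: Wunit => // a; apply: hxi_eps].
have [Frig Fpoch Flocal Funiq] := rank_data_properties zeta_inj zeta_root zetaE
  (fun _ => heta1) xiF_inj sum1k (fun a => hxi_eps _) idx1 hk Fsys Firr rkF Fdata Frefl.
have [Grig Gpoch Glocal Guniq] := rank_data_properties zeta_inj zeta_root zetaE
  (fun _ => heta2) xiG_inj sum1k (fun a => hxi_eps _) idx1 hk Gsys Girr rkG Gdata Grefl.
have [Lt [Ltsys Ltirr Ltdata Ltrefl Lt1]] := disc_exists hl eta12 hlambda1 eta10 heta1 heta2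
  hlambda0 hlambda_eta fuchs.
have [Ltrig Ltpoch Ltlocal Ltuniq] := disc_rank_data_properties hl eta12 hlambda1
  Ltirr Ltdata Ltrefl Lt1.
have sum_mE g : (\sum_a g (m a) = (k - 1) * g l + g (l - 1) + g 1)%N.
  exact: sum_multiplicities.
have sum_m : (\sum_a m a = k * l)%N.
  by rewrite (sum_mE id) /=; clear -hk hl; nia.
(* The sum of squares is k l^2 - 2 l + 2, so the index of rigidity 2 l + sum m_a^2 - k l^2 equals
   2. *)
have idx : (k * l ^ 2 < l.*2 + \sum_a m a ^ 2)%N.
  by rewrite (sum_mE (fun t => t ^ 2)%N) -!mulnn; clear -hk hl; nia.
have [FD _ FW] := Fdata; have [GD _ GW] := Gdata.
rewrite !muln1 in rkF rkG.
have FGW a : ((l - 1) * \rank (F Omega_inf - (xi a)%:M)%R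
    + \rank (G Omega_inf - (xi a)%:M)%R + m a <= k * l)%N.
  have leF : (\rank (F Omega_inf - (xi a)%:M)%R + (a != ord_max) <= k)%N.
    case: (unliftP ord_max a) => [i ->|->].
      by rewrite eq_sym neq_lift; apply: leq_trans (FW i) (eq_leq rkF).
    by rewrite eqxx addn0; apply: leq_trans (rank_leq_row _) (eq_leq rkF).
  have leG : (\rank (G Omega_inf - (xi a)%:M)%R + (a != inord (k - 1)) <= k)%N.
    case: (unliftP (inord (k - 1)) a) => [i ->|->].
      by rewrite eq_sym neq_lift; apply: leq_trans (GW i) (eq_leq rkG).
    by rewrite eqxx addn0; apply: leq_trans (rank_leq_row _) (eq_leq rkG).
  move: leF leG; rewrite -!val_eqE /= inordK; last by clear -hk; lia.
  exact: multiplicity_bound.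
have [L [Lsys Lirr rkL [Ldata Lrefl] Lext]] := extension_exists zetaE hk hl
  hlambda0 hlambda1 heta1 heta2 eta12 xi_inj sum_m hxi_eps Fsys Gsys rkF rkG FD GD
  (Frefl 0) (Grefl 0) FGW Ltsys Ltirr Ltdata Ltrefl (proj1 Ltpoch).
have [Lrig Lpoch Llocal Luniq] := rank_data_properties zeta_inj zeta_root zetaE
  hlambda1 xi_inj sum_m hxi_eps idx hk Lsys Lirr rkL Ldata Lrefl.
exists F, G, Lt; split.
- split.
    split; [exact: Fsys | exact: Firr | exact: Frig | exact: Fpoch | split=> [//|]].
    by move=> F' Fsys' /(local_data_rank sum1k)[Fdata' rkF']; apply: Funiq.
  split; [exact: Gsys | exact: Girr | exact: Grig | exact: Gpoch | split=> [//|]].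
  by move=> G' Gsys' /(local_data_rank sum1k)[Gdata' rkG']; apply: Guniq.
- by split.
exists L; split=> //.
- by split=> //; case: Llocal => _ _ _ _; apply: diagonalizable_scalar_blocks.
- split; first by apply: Lext; case: Lpoch.
  move=> L' Lsys' ext'.
  have [Ldata' rkL'] := extension_unique hk hl rkF rkG FD GD FGW Ltdata Ltrefl Lsys' ext'.
  exact: Luniq.
Qed.
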